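(* Assume the Continuum Hypothesis. Let $n$ be a positive integer and let $d_1,d_2$ be real numbers with $0<d_1\leq d_2<n$. Then the measure spaces $\left(\mathbb{R}^n,\mathcal{M}_{\mathcal{H}^{d_1}},\mathcal{H}^{d_1}\right)$ and $\left(\mathbb{R}^n,\mathcal{M}_{\mathcal{H}^{d_2}},\mathcal{H}^{d_2}\right)$ are isomorphic.
   Context: $\mathcal{H}^d$ denotes $d$-dimensional Hausdorff (outer) measure on $\mathbb{R}^n$, and $\mathcal{M}_{\mathcal{H}^d}$ denotes the $\sigma$-algebra of subsets of $\mathbb{R}^n$ that are measurable with respect to $\mathcal{H}^d$ in the sense of Carath\'eodory. An isomorphism of two measure spaces $(X,\mathcal{S},\mu)$ and $(Y,\mathcal{T},\nu)$ is a bijection $f:X\to Y$ such that both $f$ and $f^{-1}$ are measurable-set preserving and measure preserving; that is, $f(S)\in\mathcal{T}$ and $\nu(f(S))=\mu(S)$ for every $S\in\mathcal{S}$, and $f^{-1}(T)\in\mathcal{S}$ and $\mu(f^{-1}(T))=\nu(T)$ for every $T\in\mathcal{T}$. Two measure spaces are isomorphic if there is an isomorphism between them. *)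

(* Defs.v *)
From HB Require Import structures.
From mathcomp Require Import all_boot all_order all_algebra.
From mathcomp Require Import all_classical all_reals all_analysis.
Set Implicit Arguments.
Unset Strict Implicit.
Unset Printing Implicit Defensive.
Import Order.TTheory GRing.Theory Num.Theory.
Import numFieldNormedType.Exports.
Local Open Scope classical_set_scope.
Local Open Scope ring_scope.

Definition continuum_hypothesis (R : realType) : Prop :=
  forall A : set R, countable A \/ (A #= [set: R])%card.

Section hausdorff_outer_measure.
Context (R : realType) (n : nat).
Local Open Scope ereal_scope.
Implicit Types (A U : set 'rV[R]_n) (d delta : R).

(* The library norm on row vectors is the sup norm; Hausdorff measure is taken
   with respect to the Euclidean distance. *)
Definition eucl_dist (x y : 'rV[R]_n) : R :=
  Num.sqrt (\sum_(i < n) (x ord0 i - y ord0 i) ^+ 2)%R.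

Definition diam U : \bar R :=
  ereal_sup [set (eucl_dist x y)%:E | x in U & y in U].

(* As [diam set0 = -oo], the convention that the empty set contributes 0 is
   made explicit; it holds for every [d], including [d = 0]. *)
Definition diam_pow d U : \bar R :=
  if U == set0 then 0 else poweR (diam U) d.

Definition delta_covers delta A : set (set 'rV[R]_n)^nat :=
  [set U : (set 'rV[R]_n)^nat |
    (forall i, diam (U i) <= delta%:E) /\ A `<=` \bigcup_i U i].

Definition hausdorff_pre d delta A : \bar R :=
  ereal_inf [set \sum_(i <oo) diam_pow d (U i) | U in delta_covers delta A].

(* No dimensional normalizing constant is included. *)
Definition hausdorff d A : \bar R :=
  ereal_sup [set hausdorff_pre d delta A | delta in [set delta | (0 < delta)%R]].

Lemma diam0 : diam set0 = -oo.
Proof.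
rewrite /diam (_ : [set _ | _ in _ & _ in _] = set0) ?ereal_sup0//.
by rewrite -subset0 => _ [x []].
Qed.

Lemma diam_pow0 d : diam_pow d set0 = 0.
Proof. by rewrite /diam_pow eqxx. Qed.

Lemma diam_pow_ge0 d U : 0 <= diam_pow d U.
Proof. by rewrite /diam_pow; case: ifPn => // _; exact: poweR_ge0. Qed.
#[local] Hint Resolve diam_pow_ge0 : core.

Lemma hausdorff_pre_ge0 d delta A : 0 <= hausdorff_pre d delta A.
Proof.
by apply: le_ereal_inf_tmp => _ [U _ <-]; apply: nneseries_ge0 => *.
Qed.

Lemma hausdorff_pre0 d delta : hausdorff_pre d delta set0 = 0.
Proof.
apply/eqP; rewrite eq_le hausdorff_pre_ge0 andbT.
apply: ereal_inf_lbound; exists (fun=> set0).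
  by split=> // i; rewrite diam0 leNye.
by rewrite eseries0// => i _ _; rewrite diam_pow0.
Qed.

Lemma le_hausdorff_pre d delta :
  {homo hausdorff_pre d delta : A B / A `<=` B >-> A <= B}.
Proof.
move=> A B AB; apply/ereal_inf_le_tmp => _ [U [mU BU] <-].
by exists U => //; split => //; exact: subset_trans AB BU.
Qed.

Lemma hausdorff_pre_sigma_subadditive d delta :
  sigma_subadditive (hausdorff_pre d delta).
Proof.
move=> A; have [[i ioo]|] := pselect (exists i, hausdorff_pre d delta (A i) = +oo).
  rewrite (eseries_pinfty _ _ ioo) ?leey// => m _.
  by rewrite -ltNye (lt_le_trans _ (hausdorff_pre_ge0 _ _ _)).
rewrite -forallNE => Aoo.
suff add2e (e : {posnum R}) : hausdorff_pre d delta (\bigcup_n A n) <=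
    \sum_(i <oo) hausdorff_pre d delta (A i) + e%:num%:E.
  by apply/lee_addgt0Pr => _/posnumP[].
rewrite (le_trans _ (epsilon_trick _ _ _))//; last first.
  by move=> m; exact: hausdorff_pre_ge0.
pose P m (B : (set 'rV[R]_n)^nat) := delta_covers delta (A m) B /\
  \sum_(k <oo) diam_pow d (B k) <=
    hausdorff_pre d delta (A m) + (e%:num / (2 ^ m.+1)%:R)%:E.
have [G PG] : {G : ((set 'rV[R]_n)^nat)^nat & forall m, P m (G m)}.
  apply: (@choice _ _ P) => m.
  have fS : hausdorff_pre d delta (A m) \is a fin_num.
    by rewrite ge0_fin_numE ?hausdorff_pre_ge0// ltey; apply/eqP/Aoo.
  have en1 : (0 < e%:num / (2 ^ m.+1)%:R)%R by [].
  have [_ [B cB <-] xS] := lb_ereal_inf_adherent en1 fS.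
  by exists B; split => //; exact: ltW.
have /card_esym/ppcard_eqP[f] := card_nat2.
apply: (@le_trans _ _ (\sum_(k <oo) diam_pow d ((uncurry G \o f) k))).
  apply: ereal_inf_lbound; exists (uncurry G \o f) => //; split.
    by move=> i /=; rewrite /uncurry; case: (f i) => a b; exact: (PG a).1.1.
  move=> t [i _ /((PG i).1.2)[j _ Gt]].
  by exists (f^-1%FUN (i, j)) => //=; rewrite invK ?inE.
rewrite nneseries_esumT//.
rewrite -(reindex_esum [set: nat] [set: nat * nat] f (diam_pow d \o uncurry G))//.
have -> : [set: nat * nat] = [set: nat] `*`` (fun=> [set: nat]).
  by apply/seteqP; split => -[].
rewrite (eq_esum (b := fun k => diam_pow d (G k.1 k.2))); last by move=> [].
rewrite -(@esum_esum _ _ _ _ _ (fun i j => diam_pow d (G i j)))//.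
rewrite nneseries_esumT; last first.
  by move=> m; rewrite adde_ge0 ?hausdorff_pre_ge0.
apply: le_esum => m _; rewrite -nneseries_esumT//; exact: (PG m).2.
Qed.

Lemma hausdorff_pre_le d delta A : (0 < delta)%R ->
  hausdorff_pre d delta A <= hausdorff d A.
Proof. by move=> delta0; apply: ereal_sup_ubound; exists delta. Qed.

Lemma hausdorff_ge0 d A : 0 <= hausdorff d A.
Proof.
exact: le_trans (hausdorff_pre_ge0 d 1 A) (hausdorff_pre_le _ _ ltr01).
Qed.

Lemma hausdorff0 d : hausdorff d set0 = 0.
Proof.
apply/eqP; rewrite eq_le hausdorff_ge0 andbT.
by apply: ge_ereal_sup => _ [delta _ <-]; rewrite hausdorff_pre0.
Qed.

Lemma le_hausdorff d : {homo hausdorff d : A B / A `<=` B >-> A <= B}.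
Proof.
move=> A B AB; apply: ge_ereal_sup => _ [delta delta0 <-].
exact: le_trans (le_hausdorff_pre _ _ AB) (hausdorff_pre_le _ _ delta0).
Qed.

Lemma hausdorff_sigma_subadditive d : sigma_subadditive (hausdorff d).
Proof.
move=> A; apply: ge_ereal_sup => _ [delta delta0 <-].
apply: le_trans (hausdorff_pre_sigma_subadditive _ _ _) _.
by apply: lee_nneseries => *; [exact: hausdorff_pre_ge0|exact: hausdorff_pre_le].
Qed.

HB.instance Definition _ d := isOuterMeasure.Build R 'rV[R]_n (hausdorff d)
  (hausdorff0 d) (hausdorff_ge0 d) (@le_hausdorff d)
  (@hausdorff_sigma_subadditive d).

(* The restriction of [hausdorff d] to its Caratheodory-measurable sets. *)
Definition hausdorff_measure d :
    set (caratheodory_type (hausdorff d)) -> \bar R := hausdorff d.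
Arguments hausdorff_measure : clear implicits.

HB.instance Definition _ d := isMeasure.Build _ _ _ (hausdorff_measure d)
  (@caratheodory_measure0 R _ (hausdorff d))
  (@caratheodory_measure_ge0 R _ (hausdorff d))
  (@caratheodory_measure_sigma_additive R _ (hausdorff d)).

End hausdorff_outer_measure.
Arguments hausdorff_measure {R} n d A.

Section measure_space_isomorphism.
Context (R : realType) (dX dY : measure_display).
Context (X : measurableType dX) (Y : measurableType dY).

Definition measure_space_isomorphism (mu : {measure set X -> \bar R})
    (nu : {measure set Y -> \bar R}) (f : X -> Y) : Prop :=
  [/\ bijective f,
      forall S : set X, measurable S ->
        measurable (f @` S) /\ nu (f @` S) = mu S &
      forall T : set Y, measurable T ->
        measurable (f @^-1` T) /\ mu (f @^-1` T) = nu T].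

Definition measure_spaces_isomorphic (mu : {measure set X -> \bar R})
    (nu : {measure set Y -> \bar R}) : Prop :=
  exists f : X -> Y, measure_space_isomorphism mu nu f.

End measure_space_isomorphism.

(* Main.v *)
Require Import Defs.
From mathcomp Require Import all_boot all_order all_algebra.
From mathcomp Require Import all_classical all_reals all_analysis.
From mathcomp Require Import measurable_realfun.
From mathcomp Require Import ring lra.
From mathcomp Require wochoice.

(** Fix [d] with [0 < d < n] and write H for Hausdorff measure of dimension [d].
    The idea is that under the continuum hypothesis the whole measure space
    splits into blocks, indexed by the reals, which are all isomorphic to the
    half-line with Lebesgue measure, and that the way in which the blocks are
    put together does not depend on [d].

    Three facts about H are needed. Open sets are Caratheodory measurable, as H
    is a metric outer measure [separation_caratheodory]. Every set of finite
    measure has a hull of the same measure that is a countable intersection of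
    countable unions of closed sets [hausdorff_hull]; there are only continuum
    many such hulls, and through them measurable sets of finite measure are
    approximated from inside by compact sets [hausdorff_compact_approx].
    Finally, H is far from being sigma-finite: there is a family of disjoint
    closed sets of positive finite measure indexed by all binary sequences
    [hausdorff_disjoint_family].

    Under the continuum hypothesis the hulls of finite measure can be enumerated
    along a well-order whose initial segments are countable. Removing from each
    hull its predecessors gives a partition of the space into measurable fibers
    of finite measure, and a set of finite measure meets only countably many of
    them [hausdorff_partition]. Consequently a set is measurable as soon as its
    traces on the fibers are [fiberwise_measurable], and its measure is the sum
    of the measures of the traces if countably many are nonempty, and infinite
    otherwise. The disjoint family shows that uncountably many fibers have
    positive measure, so that countable groups of fibers can be formed, indexed
    by the reals, in which the measure is sigma-finite and infinite
    [hausdorff_blocks]. These are the blocks.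

    On a block there is an injective measurable real function; composed with the
    distribution function of its image measure, which is continuous because
    points are null, it carries H to Lebesgue measure on the half-line
    [distr_lebesgue]. By Lusin's theorem it is continuous on compact sets that
    exhaust the block up to a null set, so images of measurable sets are Borel
    up to null sets [spread_image]. A block for the dimension [d1] and a block
    for [d2] are therefore isomorphic up to null sets. Each block also contains
    an uncountable null set [hausdorff_uncountable_null], so the null sets left
    over on the two sides can be taken to be uncountable; by the continuum
    hypothesis they are equinumerous, and the isomorphism extends to a bijection
    [block_isomorphism]. The bijections between corresponding blocks are glued
    together; the result preserves measurability and measure because both are
    determined by the traces on the blocks in the same way for [d1] and for [d2]
    [glued_image]. *)

Import numFieldNormedType.Exports.
Import Order.TTheory GRing.Theory Num.Theory.
Set Implicit Arguments.
Unset Strict Implicit.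
Unset Printing Implicit Defensive.
Local Open Scope classical_set_scope.
Local Open Scope ring_scope.

(** * Expansions with separated digits *)

Section expansion.
Context {R : realType}.
Implicit Types (rho : R) (a : nat -> nat) (b k m : nat).

(** For [b%:R * rho < 1] the digits below [b] leave gaps between the cylinders,
    so that, unlike for ordinary expansions in base [b], the digits can be read
    off the value, with an explicit error bound. *)
Definition expansion rho a : R :=
  limn (series (fun k => rho ^+ k * (a k)%:R)).

Section bounded_digits.
Context {rho : R} {b : nat}.
Hypotheses (rho0 : 0 < rho) (brho : b%:R * rho < 1).

(** The upper bound reproduces itself when a digit is put in front, because
    [(b - 1) + rho * b <= b]. *)
Lemma expansion_sum_le a m : (forall k, (a k < b)%N) ->
  0 <= series (fun k => rho ^+ k * (a k)%:R) m <= b%:R.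
Proof.
elim: m a => [|m IH] a ab; rewrite /series/=; first by rewrite big_nil lexx/=.
rewrite big_nat_recl// expr0 mul1r.
have := IH (fun k => a k.+1) (fun k => ab k.+1).
rewrite /series/= => /andP[s0 sb].
have -> : \sum_(0 <= i < m) rho ^+ i.+1 * (a i.+1)%:R =
    rho * \sum_(0 <= i < m) rho ^+ i * (a i.+1)%:R.
  by rewrite mulr_sumr; apply: eq_bigr => i _; rewrite exprS mulrA.
rewrite addr_ge0 ?mulr_ge0 ?(ltW rho0)//=.
have a0 : (a 0)%:R + 1 <= b%:R :> R by rewrite natr1 ler_nat ab.
have : rho * \sum_(0 <= i < m) rho ^+ i * (a i.+1)%:R <= 1.
  by rewrite (le_trans _ (ltW brho))// mulrC ler_pM2r.
lra.
Qed.

Lemma expansion_cvg a : (forall k, (a k < b)%N) ->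
  cvgn (series (fun k => rho ^+ k * (a k)%:R)).
Proof.
move=> ab; apply: nondecreasing_is_cvgn.
  apply/nondecreasing_seqP => k; rewrite /series/= big_nat_recr//= lerDl.
  by rewrite mulr_ge0// exprn_ge0// ltW.
by exists b%:R => _ [m _ <-]; have /andP[] := expansion_sum_le m ab.
Qed.

Lemma expansion_bounds a : (forall k, (a k < b)%N) ->
  0 <= expansion rho a <= b%:R.
Proof.
move=> ab; apply/andP; split.
  apply: limr_ge; first exact: expansion_cvg.
  by apply: nearW => m; have /andP[] := expansion_sum_le m ab.
apply: limr_le; first exact: expansion_cvg.
by apply: nearW => m; have /andP[] := expansion_sum_le m ab.
Qed.

Lemma expansionS a : (forall k, (a k < b)%N) ->
  expansion rho a = (a 0)%:R + rho * expansion rho (fun k => a k.+1).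
Proof.
move=> ab; apply/cvg_lim => //.
rewrite -(cvg_shiftS _).
have -> : [sequence series (fun k => rho ^+ k * (a k)%:R) n.+1]_n =
   (fun m => (a 0)%:R + rho * series (fun k => rho ^+ k * (a k.+1)%:R) m).
  apply/funext => m; rewrite /series/= big_nat_recl// expr0 mul1r; congr (_ + _).
  by rewrite mulr_sumr; apply: eq_bigr => i _; rewrite exprS mulrA.
apply: cvgD; first exact: cvg_cst.
apply: cvgMl_tmp; apply: expansion_cvg => k; exact: ab.
Qed.

Lemma expansion_dist_le a a' k : (forall i, (a i < b)%N) ->
    (forall i, (a' i < b)%N) -> (forall i, (i < k)%N -> a i = a' i) ->
  `|expansion rho a - expansion rho a'| <= b%:R * rho ^+ k.
Proof.
elim: k a a' => [|k IH] a a' ab ab' aa'.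
  rewrite expr0 mulr1 ler_norml.
  have /andP[] := expansion_bounds ab; have /andP[] := expansion_bounds ab'.
  lra.
rewrite (expansionS ab) (expansionS ab') aa'// opprD addrACA subrr add0r -mulrBr.
rewrite normrM (gtr0_norm rho0) exprS mulrCA ler_pM2l//.
by apply: IH => // i ik; exact: aa'.
Qed.

(** At the first index where they differ the two digits are at distance at least
    [1], whereas the tails that follow both lie between [0] and [b] and are
    scaled by [rho]. *)
Lemma expansion_dist_ge a a' k : (forall i, (a i < b)%N) ->
    (forall i, (a' i < b)%N) -> (forall i, (i < k)%N -> a i = a' i) ->
    a k != a' k ->
  (1 - b%:R * rho) * rho ^+ k <= `|expansion rho a - expansion rho a'|.
Proof.
elim: k a a' => [|k IH] a a' ab ab' aa' akk.
  rewrite expr0 mulr1.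
  rewrite (expansionS ab) (expansionS ab').
  have /andP[x0 xb] := expansion_bounds (fun k => ab k.+1).
  have /andP[y0 yb] := expansion_bounds (fun k => ab' k.+1).
  set x := expansion _ _ in x0 xb *; set y := expansion _ _ in y0 yb *.
  have xM := ler_wpM2l (ltW rho0) xb; have yM := ler_wpM2l (ltW rho0) yb.
  have xm := mulr_ge0 (ltW rho0) x0; have ym := mulr_ge0 (ltW rho0) y0.
  move: akk; rewrite neq_ltn => /orP[] H; rewrite ler_normr; apply/orP;
    [right|left]; move: H; rewrite -(ler_nat R) -natr1 => H; lra.
rewrite (expansionS ab) (expansionS ab') aa'// opprD addrACA subrr add0r -mulrBr.
rewrite normrM (gtr0_norm rho0) exprS mulrCA ler_pM2l//.
by apply: IH => // i ik; exact: aa'.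
Qed.

(** The first index with different digits, if at most [k], would produce a gap
    of relative size [rho ^+ k] at least. *)
Lemma expansion_dist_lt a a' k : (forall i, (a i < b)%N) ->
    (forall i, (a' i < b)%N) ->
    `|expansion rho a - expansion rho a'| < (1 - b%:R * rho) * rho ^+ k ->
  forall i, (i <= k)%N -> a i = a' i.
Proof.
move=> ab ab' close; elim/ltn_ind => i IH ik; apply/eqP/negPn/negP => aai.
suff : (1 - b%:R * rho) * rho ^+ k <= `|expansion rho a - expansion rho a'|.
  by rewrite leNgt close.
apply: (le_trans _ (expansion_dist_ge ab ab' _ aai)).
  rewrite ler_pM2l ?subr_gt0// ler_wiXn2l ?(ltW rho0)//.
  case: b brho (ab 0%N) => // b'; rewrite -natr1 mulrDl mul1r => H _.
  by have := mulr_ge0 (ler0n R b') (ltW rho0); lra.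
by move=> j ji; apply: IH => //; rewrite (leq_trans (ltnW ji)).
Qed.

Lemma expansion_inj a a' : (forall i, (a i < b)%N) -> (forall i, (a' i < b)%N) ->
  expansion rho a = expansion rho a' -> a = a'.
Proof.
move=> ab ab' xx; apply/funext => i; apply: (expansion_dist_lt (k := i)) => //.
by rewrite xx subrr normr0 mulr_gt0 ?exprn_gt0// subr_gt0.
Qed.

End bounded_digits.
Section bit_code.

(** Base 4 rather than base 2, because two digits must leave a gap for the code
    to be injective. *)
Definition bit_code (s : nat -> bool) : R := expansion 4^-1 (fun k => s k : nat).

Let quarter0 : 0 < 4^-1 :> R. Proof. by rewrite invr_gt0. Qed.

Let quarter1 : 2%:R * 4^-1 < 1 :> R.
Proof. by rewrite ltr_pdivrMr// mul1r ltr_nat. Qed.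

Let bit_lt (s : nat -> bool) k : (s k < 2)%N. Proof. by case: (s k). Qed.

Lemma bit_code_cvg (s : nat -> bool) :
  series (fun k => 4^-1 ^+ k * (s k : nat)%:R) @ \oo --> bit_code s.
Proof. exact: (expansion_cvg quarter0 quarter1 (bit_lt s)). Qed.

Lemma bit_code_bounds s : 0 <= bit_code s <= 2.
Proof. exact: (expansion_bounds quarter0 quarter1 (bit_lt s)). Qed.

Lemma bit_code_dist_le s t k : (forall i, (i < k)%N -> s i = t i) ->
  `|bit_code s - bit_code t| <= 2 * 4^-1 ^+ k.
Proof.
move=> st; apply: (expansion_dist_le quarter0 quarter1) => // i ik.
by rewrite st.
Qed.

Lemma bit_code_inj : injective bit_code.
Proof.
move=> s t /(expansion_inj quarter0 quarter1 (bit_lt s) (bit_lt t)) st.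
apply/funext => k; have := congr1 (fun f => f k) st.
by case: (s k); case: (t k).
Qed.

End bit_code.
End expansion.

(** * The Caratheodory criterion *)

Section caratheodory_criterion.
Context {R : realType} {T : Type} (mu : {outer_measure set T -> \bar R}).
Local Open Scope ereal_scope.

(** The classical argument for metric outer measures. Inside a set [X] of finite
    measure, the part [A k] above the level [c + k.+1%:R^-1] is separated from
    the part below [c]; it remains to see that what lies between, a union of
    rings, has small measure for large [k]. Two rings with one ring between them
    are separated, which forces the series of the measures of the rings to
    converge. *)
Lemma separation_caratheodory (f : T -> R) :
    (forall (A : set T) (s t : R), (s < t)%R ->
      mu (A `&` [set x | (f x <= s)%R]) + mu (A `&` [set x | (t <= f x)%R]) <=
      mu A) ->
  forall c : R, mu.-caratheodory [set x | (f x <= c)%R].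
Proof.
move=> sep c; apply: le_caratheodory_measurable => X.
have [->|Xoo] := eqVneq (mu X) +oo; first by rewrite leey.
have Xlt : mu X < +oo by rewrite ltey.
have Xfin : mu X \is a fin_num.
  by rewrite ge0_fin_numE ?outer_measure_ge0// ltey.
pose e k : R := (c + k.+1%:R^-1)%R.
have ce k : (c < e k)%R by rewrite ltrDl invr_gt0.
have eS k : (e k.+1 < e k)%R.
  by rewrite ltrD2l ltf_pV2 ?posrE// ltr_nat.
pose A k := X `&` [set x | (e k <= f x)%R].
pose ring k := X `&` [set x | (e k.+1 <= f x < e k)%R].
have AX k : mu (A k) <= mu X by apply: le_outer_measure => x [].
(* Both sets are contained in [A k.+2], and the ring [ring k] separates them:
   the sum over [k] telescopes. *)
have ringA k : mu (ring k.+1) + mu (A k) <= mu (A k.+2).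
  apply: le_trans (sep (A k.+2) _ _ (eS k)).
  apply: leeD; apply: le_outer_measure => x [Xx /=].
    by case/andP=> h1 /ltW h2; do 2?split.
  move=> h; split => //; split => //=; apply: le_trans h.
  exact: le_trans (ltW (eS k.+1)) (ltW (eS k)).
have ring_sum m : \sum_(0 <= i < m) mu (ring i.+1) <= mu (A m) + mu (A m.+1).
  elim: m => [|m IH].
    by rewrite big_nil adde_ge0// outer_measure_ge0.
  rewrite big_nat_recr//=; apply: (le_trans (leeD2r _ IH)).
  by rewrite addeAC addeC leeD2l// addeC ringA.
have ring_fin : \sum_(0 <= i <oo) mu (ring i) < +oo.
  rewrite nneseries_recl//; last by move=> k _; exact: outer_measure_ge0.
  apply: lte_add_pinfty.
    by apply: le_lt_trans Xlt; apply: le_outer_measure => x [].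
  rewrite -(nneseries_addn (f := fun i => mu (ring i)) 1); last first.
    by move=> i; exact: outer_measure_ge0.
  apply: (@le_lt_trans _ _ (mu X + mu X)); last first.
    by rewrite lte_add_pinfty.
  apply: lime_le.
    by apply: is_cvg_nneseries => *; exact: outer_measure_ge0.
  apply: nearW => m; rewrite (eq_bigr (fun i => mu (ring i.+1))); last first.
    by move=> i _; rewrite addn1.
  by rewrite (le_trans (ring_sum m))// leeD.
have tail := nneseries_tail_cvg ring_fin
  (fun k _ => outer_measure_ge0 mu (ring k)).
have lim : mu X + \sum_(N <= k <oo) mu (ring k) @[N --> \oo] --> mu X + 0.
  by apply: cvgeD => //; [rewrite fin_num_adde_defr|exact: cvg_cst].
rewrite -[leRHS]adde0; apply: (cvge_to_ge lim); apply: nearW => N.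
apply: (@le_trans _ _ (mu (X `&` [set x | (f x <= c)%R]) +
    (mu (A N) + \sum_(N <= k <oo) mu (ring k)))).
  rewrite leeD2l//; apply: (@le_trans _ _
    (mu (A N `|` \bigcup_(k in ~` `I_N) ring k))).
    apply: le_outer_measure => x [Xx /= /negP]; rewrite -ltNge => cfx.
    have [?|fxN] := lerP (e N) (f x); [by left|right].
    have /ltr_add_invr[k] := cfx; rewrite -/(e k) => ek.
    have exk : exists k, (e k <= f x)%R by exists k; exact: ltW.
    have := ex_minnP exk; case=> -[|m] em mmin.
      have : (f x < e 0%N)%R.
        apply: (lt_le_trans fxN); rewrite lerD2l lef_pV2 ?posrE//.
        by rewrite ler_nat.
      by rewrite ltNge em.
    exists m.
      move=> /= mN.
      have : (e N <= e m.+1)%R.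
        by rewrite lerD2l lef_pV2 ?posrE// ler_nat !ltnS.
      by move=> /le_trans/(_ em); rewrite leNgt fxN.
    split => //=; rewrite em/= ltNge; apply/negP => /mmin.
    by rewrite ltnn.
  apply: (le_trans (outer_measureU2 mu _ _)); rewrite leeD2l//.
  exact: outer_measure_sigma_subadditive_tail.
rewrite addeA leeD2r//; exact: sep.
Qed.
End caratheodory_criterion.

(** * Elementary properties of Hausdorff measure *)

Section hausdorff_basics.
Context {R : realType} {n : nat}.
Local Open Scope ereal_scope.
Implicit Types (A B U : set 'rV[R]_n) (x y : 'rV[R]_n) (d : R).

Lemma eucl_dist_coord x y i : (`|x ord0 i - y ord0 i| <= eucl_dist x y)%R.
Proof.
rewrite /eucl_dist -sqrtr_sqr ler_sqrt ?sumr_ge0// => [|j _]; last exact: sqr_ge0.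
by rewrite (bigD1 i)//= lerDl sumr_ge0// => j _; exact: sqr_ge0.
Qed.

Lemma eucl_dist_le x y (r : R) : (0 <= r)%R ->
  (forall i, `|x ord0 i - y ord0 i| <= r)%R -> (eucl_dist x y <= n%:R * r)%R.
Proof.
move=> r0 xyr; rewrite /eucl_dist -[leRHS]ger0_norm ?mulr_ge0//.
rewrite -sqrtr_sqr ler_sqrt ?sqr_ge0//.
apply: (@le_trans _ _ (\sum_(i < n) r ^+ 2)%R).
  by apply: ler_sum => i _; rewrite -real_normK ?num_real// lerXn2r ?nnegrE.
rewrite sumr_const card_ord -[leLHS]mulr_natl exprMn ler_wpM2r ?sqr_ge0//.
rewrite -natrX ler_nat -mulnn.
by have [n0|n0] := posnP n; [rewrite {1}n0|rewrite leq_pmulr].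
Qed.

Lemma eucl_dist_ge0 x y : (0 <= eucl_dist x y)%R.
Proof. exact: sqrtr_ge0. Qed.

Lemma eucl_distxx x : eucl_dist x x = 0%R.
Proof.
by rewrite /eucl_dist big1 ?sqrtr0// => i _; rewrite subrr expr0n.
Qed.

Lemma eucl_dist_le_diam U x y : U x -> U y -> (eucl_dist x y)%:E <= diam U.
Proof. by move=> Ux Uy; apply: ereal_sup_ubound; exists x => //; exists y. Qed.

Lemma diam_le U (r : \bar R) :
  (forall x y, U x -> U y -> (eucl_dist x y)%:E <= r) -> diam U <= r.
Proof. by move=> Ur; apply: ge_ereal_sup => _ [x Ux [y Uy <-]]; exact: Ur. Qed.

Lemma le_diam : {homo @diam R n : A B / A `<=` B >-> A <= B}.
Proof.
by move=> A B AB; apply: diam_le => x y Ax Ay; apply: eucl_dist_le_diam; exact: AB.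
Qed.

Lemma diam_ge0 U : U !=set0 -> 0 <= diam U.
Proof. move=> [x Ux]; apply: le_trans (eucl_dist_le_diam Ux Ux).
by rewrite lee_fin eucl_dist_ge0. Qed.

Lemma le_diam_pow d : (0 <= d)%R ->
  {homo @diam_pow R n d : A B / A `<=` B >-> A <= B}.
Proof.
move=> d0 A B AB; rewrite /diam_pow; case: ifPn => [_|A0].
  by case: ifPn => // _; exact: poweR_ge0.
have A0' : A !=set0 by exact/set0P.
have B0' : B !=set0 by case: A0' => x /AB; exists x.
have [/eqP B0|_] := ifPn; first by case: B0' => x; rewrite B0.
apply: gt0_ler_poweR; rewrite ?in_itv/= ?andbT ?leey ?diam_ge0//.
exact: le_diam.
Qed.

Lemma hausdorff_pre_le_diam_pow d (delta : R) U : diam U <= delta%:E ->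
  (0 < delta)%R -> hausdorff_pre d delta U <= diam_pow d U.
Proof.
move=> Udelta delta0; apply: ereal_inf_lbound.
exists (fun i => if i == 0%N then U else set0).
  split; last by move=> x Ux; exists 0%N.
  by case=> //= i; rewrite diam0 leNye.
rewrite nneseries_recl//; last by move=> k _; exact: diam_pow_ge0.
by rewrite eseries0 ?adde0// => -[|i]//= _ _; rewrite diam_pow0.
Qed.

Lemma le_hausdorff_pre_mesh d A : {in Num.pos &,
  {homo (fun delta => hausdorff_pre d delta A) : s t / (s <= t)%R >-> t <= s}}.
Proof.
move=> s t _ _ st; apply: ereal_inf_le_tmp => _ [U [Us AU] <-]; exists U => //.
by split => // i; rewrite (le_trans (Us i))// lee_fin.
Qed.

(** A set of diameter less than [e] meets at most one of [A] and [B], so that a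
    fine cover of the union splits into a cover of [A] and a cover of [B]
    without increasing its cost. *)
Lemma hausdorff_separated d (A B : set 'rV[R]_n) (e : R) : (0 <= d)%R ->
  (0 < e)%R -> (forall x y, A x -> B y -> (e <= eucl_dist x y)%R) ->
  hausdorff d A + hausdorff d B <= hausdorff d (A `|` B).
Proof.
move=> d0 e0 sep.
have pre (s : R) : (0 < s < e)%R ->
    hausdorff_pre d s A + hausdorff_pre d s B <= hausdorff_pre d s (A `|` B).
  move=> /andP[s0 se]; apply: le_ereal_inf_tmp => _ [U [Us UAB] <-].
  apply: (@le_trans _ _ (\sum_(i <oo) diam_pow d (U i `&` A) +
                         \sum_(i <oo) diam_pow d (U i `&` B))).
    apply: leeD; apply: ereal_inf_lbound.
      exists (fun i => U i `&` A) => //; split => [i|x Ax].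
        by apply: le_trans (Us i); apply: le_diam => x [].
      by have [|i _ Ui] := UAB x; [left|exists i].
    exists (fun i => U i `&` B) => //; split => [i|x Ax].
      by apply: le_trans (Us i); apply: le_diam => x [].
    by have [|i _ Ui] := UAB x; [right|exists i].
  rewrite -nneseriesD; try by move=> *; exact: diam_pow_ge0.
  apply: lee_nneseries => [i _|i _].
    by rewrite adde_ge0// diam_pow_ge0.
  have [->|/set0P[x [Ux Ax]]] := eqVneq (U i `&` A) set0.
    by rewrite diam_pow0 add0e; apply: le_diam_pow => // x [].
  rewrite (_ : U i `&` B = set0) ?diam_pow0 ?adde0.
    by apply: le_diam_pow => // y [].
  apply/seteqP; split => // y [Uy By].
  have := sep _ _ Ax By; apply/negP; rewrite -ltNge.
  by rewrite -lte_fin (le_lt_trans (eucl_dist_le_diam Ux Uy))// (le_lt_trans (Us i)).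
(* The two suprema over the mesh are bounded at a common mesh, chosen below
   [e] as well so that covers split. *)
have key (s t : R) : (0 < s)%R -> (0 < t)%R ->
    hausdorff_pre d s A + hausdorff_pre d t B <= hausdorff d (A `|` B).
  move=> s0 t0; pose m : R := Order.min (e / 2)%R (Order.min s t).
  have m0 : (0 < m)%R by rewrite !lt_min s0 t0 divr_gt0.
  have me : (0 < m < e)%R.
    by rewrite m0 gt_min; apply/orP; left; rewrite ltr_pdivrMr// ltr_pMr// ltr1n.
  apply: le_trans (hausdorff_pre_le _ _ m0); apply: le_trans (pre _ me).
  by apply: leeD; apply: le_hausdorff_pre_mesh; rewrite ?posrE// !ge_min lexx ?orbT.
have [->|Boo] := eqVneq (hausdorff d B) 0.
  by rewrite adde0; apply: le_hausdorff; exact: subsetUl.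
have [Uoo|Uoo] := eqVneq (hausdorff d (A `|` B)) +oo; first by rewrite Uoo leey.
have Ufin : hausdorff d (A `|` B) \is a fin_num.
  by rewrite ge0_fin_numE ?hausdorff_ge0// ltey.
have Bfin : hausdorff d B \is a fin_num.
  rewrite ge0_fin_numE ?hausdorff_ge0//; apply: (@le_lt_trans _ _ (hausdorff d (A `|` B))).
    by apply: le_hausdorff; exact: subsetUr.
  by rewrite ltey.
rewrite -leeBrDr//; apply: ge_ereal_sup => _ [s s0 <-].
have preA : hausdorff_pre d s A \is a fin_num.
  rewrite ge0_fin_numE ?hausdorff_pre_ge0//.
  apply: (@le_lt_trans _ _ (hausdorff d (A `|` B))); last by rewrite ltey.
  apply: le_trans (hausdorff_pre_le _ _ s0) _.
  by apply: le_hausdorff; exact: subsetUl.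
rewrite leeBrDr// addeC -leeBrDr//; apply: ge_ereal_sup => _ [t t0 <-].
by rewrite leeBrDr// addeC; exact: key.
Qed.

(** Two levels [s < t] of a 1-Lipschitz function are at distance at least
    [t - s]. *)
Lemma measurable_lipschitz_le d (f : 'rV[R]_n -> R) (c : R) : (0 <= d)%R ->
  (forall x y, `|f x - f y| <= eucl_dist x y)%R ->
  (hausdorff d).-cara.-measurable [set x : 'rV[R]_n | (f x <= c)%R].
Proof.
move=> d0 lf; apply: (@separation_caratheodory _ _ _ f).
move=> A s t st.
apply: le_trans (hausdorff_separated (e := (t - s)%R) d0 _ _) _.
- by rewrite subr_gt0.
- move=> x y [_ /= xs] [_ /= ty]; apply: le_trans (lf x y).
  by rewrite distrC ler_normr; apply/orP; left; lra.
- by apply: le_hausdorff => x [[]|[]].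
Qed.

Lemma measurable_coord_le d (i : 'I_n) (c : R) : (0 <= d)%R ->
  (hausdorff d).-cara.-measurable [set x : 'rV[R]_n | (x ord0 i <= c)%R].
Proof.
move=> d0; apply: (measurable_lipschitz_le (f := fun x => x ord0 i)) => // x y.
exact: eucl_dist_coord.
Qed.

Lemma measurable_coord_ge d (i : 'I_n) (c : R) : (0 <= d)%R ->
  (hausdorff d).-cara.-measurable [set x : 'rV[R]_n | (c <= x ord0 i)%R].
Proof.
move=> d0; rewrite (_ : [set x | _] = [set x : 'rV[R]_n | (- x ord0 i <= - c)%R]).
  apply: (measurable_lipschitz_le (f := fun x => (- x ord0 i)%R)) => // x y.
  by rewrite -opprD normrN; exact: eucl_dist_coord.
by apply/seteqP; split => x /=; rewrite lerN2.
Qed.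

End hausdorff_basics.

(** * Measurability of open and closed sets *)

Section rational_boxes.
Context {R : realType} {n : nat}.
Implicit Types (A : set 'rV[R]_n) (x y : 'rV[R]_n) (d : R).

Definition rat_box (pq : 'rV[rat]_n * 'rV[rat]_n) : set 'rV[R]_n :=
  [set x | forall i, ratr (pq.1 ord0 i) < x ord0 i < ratr (pq.2 ord0 i)].

Lemma open_rat_box pq : open (rat_box pq).
Proof.
rewrite openE => x xpq; exists (fun _ i => [set t : R |
    ratr (pq.1 ord0 i) < t < ratr (pq.2 ord0 i)]).
  move=> i j; rewrite ord1; have /andP[h1 h2] := xpq j.
  have : nbhs (x ord0 j) `]ratr (pq.1 ord0 j), ratr (pq.2 ord0 j)[%classic.
    by apply: near_in_itvoo; rewrite in_itv/= h1.
  by apply: filterS => t /=; rewrite in_itv.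
by move=> y yP i; exact: yP.
Qed.

Lemma rat_box_nbhs A x : nbhs x A -> exists2 pq, rat_box pq x & rat_box pq `<=` A.
Proof.
move=> [P xP PA].
have H i : {pq : rat * rat | ratr pq.1 < x ord0 i < ratr pq.2 &
   forall t : R, ratr pq.1 < t < ratr pq.2 -> P ord0 i t}.
  apply: cid2; have /nbhs_ballP[e /= e0 eP] := xP ord0 i.
  have /rat_in_itvoo[p /itvP pe] : x ord0 i - e < x ord0 i by rewrite ltrBlDr ltrDl.
  have /rat_in_itvoo[q /itvP qe] : x ord0 i < x ord0 i + e by rewrite ltrDl.
  exists (p, q); first by rewrite /= pe qe.
  move=> t /= /andP[pt tq]; apply: eP; rewrite /ball/= ltr_norml.
  have := pe; have := qe => qe' pe'.
  have e1 : x ord0 i - e < ratr p by rewrite pe'.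
  have e2 : ratr q < x ord0 i + e by rewrite qe'.
  by apply/andP; split; lra.
exists (\row_i (s2val (H i)).1, \row_i (s2val (H i)).2).
  by move=> i /=; rewrite !mxE; exact: (s2valP (H i)).
move=> y yb; apply: PA => i j; rewrite ord1; apply: (s2valP' (H j)).
by have := yb j; rewrite /= !mxE.
Qed.

Lemma open_bigcup_rat_box A : open A ->
  A = \bigcup_(pq in [set pq | rat_box pq `<=` A]) rat_box pq.
Proof.
move=> oA; apply/seteqP; split => [x Ax|x [pq pqA]]; last exact: pqA.
have [|pq xpq pqA] := @rat_box_nbhs A x; first exact: open_nbhs_nbhs.
by exists pq.
Qed.

Lemma measurable_rat_box d pq : 0 <= d ->
  (hausdorff d).-cara.-measurable (rat_box pq).
Proof.
move=> d0; rewrite (_ : rat_box pq = \bigcap_(i in [set: 'I_n])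
    (~` [set x | x ord0 i <= ratr (pq.1 ord0 i)] `&`
     ~` [set x | ratr (pq.2 ord0 i) <= x ord0 i])).
  apply: fin_bigcap_measurable => // i _.
  apply: measurableI; apply: measurableC.
    exact: measurable_coord_le.
  exact: measurable_coord_ge.
apply/seteqP; split => x /= xpq i.
  by move=> _; have /andP[h1 h2] := xpq i; split; apply/negP; rewrite -ltNge.
by have [/negP h1 /negP h2] := xpq i I; rewrite !ltNge h1 h2.
Qed.

Lemma measurable_bigcup_rat_box d (D : set ('rV[rat]_n * 'rV[rat]_n)) : 0 <= d ->
  (hausdorff d).-cara.-measurable (\bigcup_(pq in D) rat_box pq).
Proof.
move=> d0; rewrite bigcup_mkcond.
apply: countable_bigcupT_measurable; first exact: countableP.
by move=> pq; case: ifPn => // _; exact: measurable_rat_box.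
Qed.

Lemma hausdorff_open_measurable d A : 0 <= d -> open A ->
  (hausdorff d).-cara.-measurable A.
Proof.
by move=> d0 /open_bigcup_rat_box ->; exact: measurable_bigcup_rat_box.
Qed.

Lemma hausdorff_closed_measurable d A : 0 <= d -> closed A ->
  (hausdorff d).-cara.-measurable A.
Proof.
move=> d0 cA; rewrite -(setCK A); apply: measurableC.
by apply: hausdorff_open_measurable => //; exact: closed_openC.
Qed.

Lemma continuous_eucl_dist y : continuous (fun x => eucl_dist x y).
Proof.
have sumc (s : seq 'I_n) :
    continuous (fun z : 'rV[R]_n => \sum_(j <- s) (z ord0 j - y ord0 j) ^+ 2).
  elim: s => [|i s IH].
    rewrite (_ : (fun _ => _) = cst 0); first exact: cst_continuous.
    by apply/funext => z; rewrite big_nil.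
  have cB : continuous (fun z : 'rV[R]_n => z ord0 i - y ord0 i).
    move=> x; apply: continuousB; last exact: cst_continuous.
    exact: (@coord_continuous R 1 n ord0 i).
  rewrite (_ : (fun _ => _) = (fun z : 'rV[R]_n =>
      (z ord0 i - y ord0 i) * (z ord0 i - y ord0 i) +
      \sum_(j <- s) (z ord0 j - y ord0 j) ^+ 2)); last first.
    by apply/funext => z; rewrite big_cons expr2.
  by move=> x; exact: (cvgD (cvgM (cB x) (cB x)) (IH x)).
move=> x; apply: (@continuous_comp _ _ _ _ (@Num.sqrt R)).
  exact: sumc.
exact: sqrt_continuous.
Qed.

Lemma eucl_distC x y : eucl_dist x y = eucl_dist y x.
Proof.
by congr Num.sqrt; apply: eq_bigr => i _; rewrite -sqrrN opprB.
Qed.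

(** Thanks to this, replacing the members of a cover by their closures changes
    neither its mesh nor its cost. *)
Lemma diam_closure A : diam (closure A) = diam A.
Proof.
apply/le_anti/andP; split; last by apply: le_diam; exact: subset_closure.
have [Aoo|Aoo] := eqVneq (diam A) +oo%E; first by rewrite Aoo leey.
have [->|/set0P[z Az]] := eqVneq A set0; first by rewrite closure0.
have : diam A \is a fin_num.
  by rewrite ge0_fin_numE ?ltey//; apply: diam_ge0; exists z.
move=> /fineK; set r := fine _ => rE.
have clo y : closed [set x | eucl_dist x y <= r].
  apply: (@preimage_closed _ _ _ [set t : R | t <= r]).
    by move=> x _; exact: continuous_eucl_dist.
  exact: closed_le.
apply: diam_le => x y Ax Ay; rewrite -rE lee_fin.
have H1 y' : A y' -> eucl_dist x y' <= r.
  move=> Ay'; have /closure_id := clo y'; set C := [set _ | _] => cl.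
  suff : closure A `<=` C by exact.
  rewrite cl; apply: closureS => z' Az'; rewrite /C/=.
  by rewrite -lee_fin rE eucl_dist_le_diam.
rewrite eucl_distC; have /closure_id := clo x; set C := [set _ | _] => cl.
suff : closure A `<=` C by exact.
by rewrite cl; apply: closureS => z' Az'; rewrite /C/=; rewrite eucl_distC H1.
Qed.

End rational_boxes.

(** * Hulls of equal measure *)

Section hulls.
Context {R : realType} {n : nat}.
Local Open Scope ereal_scope.
Implicit Types (A : set 'rV[R]_n) (x y : 'rV[R]_n) (d : R).

Definition hull_code := set (nat * nat * ('rV[rat]_n * 'rV[rat]_n)).

(** Every closed set is the complement of a union of rational boxes, so these
    are exactly the countable intersections of countable unions of closed sets.
    They are described by subsets of a countable type, so that there are only
    continuum many descriptions. *)
Definition coded_hull (s : hull_code) : set 'rV[R]_n :=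
  \bigcap_k \bigcup_i ~` \bigcup_(pq in [set pq | s (k, i, pq)]) rat_box pq.

Lemma measurable_coded_hull d s : (0 <= d)%R ->
  (hausdorff d).-cara.-measurable (coded_hull s).
Proof.
move=> d0; apply: bigcapT_measurable => k; apply: bigcupT_measurable => i.
by apply: measurableC; exact: measurable_bigcup_rat_box.
Qed.

Lemma coded_hull_closed (F : nat -> nat -> set 'rV[R]_n) :
  (forall k i, closed (F k i)) ->
  exists s, coded_hull s = \bigcap_k \bigcup_i F k i.
Proof.
move=> cF; exists [set kip | rat_box kip.2 `<=` ~` F kip.1.1 kip.1.2].
apply: eq_bigcapr => k _; apply: eq_bigcupr => i _ /=.
by rewrite -open_bigcup_rat_box ?setCK//; exact: closed_openC.
Qed.

Lemma hausdorff1 d x : (0 < d)%R -> hausdorff d [set x] = 0.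
Proof.
move=> d0; apply/eqP; rewrite eq_le hausdorff_ge0 andbT.
apply: ge_ereal_sup => _ [delta delta0 <-].
have dx : diam [set x] = 0.
  apply/eqP; rewrite eq_le diam_ge0 ?andbT; last by exists x.
  by apply: diam_le => _ _ -> ->; rewrite eucl_distxx.
apply: le_trans (hausdorff_pre_le_diam_pow _ _ delta0) _.
  by rewrite dx lee_fin ltW.
by rewrite /diam_pow; case: ifPn => // _; rewrite dx poweR0r ?gt_eqF.
Qed.

(** For each [k] take a cover of [A] of mesh [k.+1%:R^-1] whose cost exceeds the
    optimum by at most as much, and intersect over [k] the unions of the
    closures of its members: each of these covers also covers the intersection
    and bounds its measure. *)
Lemma hausdorff_hull d A : (0 < d)%R -> hausdorff d A < +oo ->
  exists s, A `<=` coded_hull s /\ hausdorff d (coded_hull s) <= hausdorff d A.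
Proof.
move=> d0 Aoo.
have H k : exists U : (set 'rV[R]_n)^nat, delta_covers k.+1%:R^-1 A U /\
    \sum_(i <oo) diam_pow d (U i) <= hausdorff d A + (k.+1%:R^-1)%:E.
  have k0 : (0 < k.+1%:R^-1 :> R)%R by rewrite invr_gt0.
  have pfin : hausdorff_pre d k.+1%:R^-1 A \is a fin_num.
    rewrite ge0_fin_numE ?hausdorff_pre_ge0//.
    exact: le_lt_trans (hausdorff_pre_le _ _ k0) Aoo.
  have [_ [U cU <-] US] := lb_ereal_inf_adherent k0 pfin.
  exists U; split => //; apply: (le_trans (ltW US)).
  by rewrite leeD2r// hausdorff_pre_le.
have [U HU] := choice H.
have [s sE] := @coded_hull_closed (fun k i => closure (U k i))
  (fun k i => @closed_closure _ (U k i)).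
exists s; rewrite sE; split.
  move=> x Ax k _; have [i _ Ui] := (HU k).1.2 x Ax.
  by exists i => //; exact: subset_closure.
apply: ge_ereal_sup => _ [delta /= delta0 <-].
apply/lee_addgt0Pr => e e0.
have m0 : (0 < Order.min delta e)%R by rewrite lt_min delta0.
have [k _ /(_ k (leqnn _)) /=] := near_infty_natSinv_lt (PosNum m0).
rewrite /= lt_min => /andP[kdelta ke].
apply: (@le_trans _ _ (\sum_(i <oo) diam_pow d (closure (U k i)))).
  apply: ereal_inf_lbound; exists (fun i => closure (U k i)) => //; split.
    move=> i; rewrite diam_closure; apply: le_trans ((HU k).1.1 i) _.
    by rewrite lee_fin ltW.
  by move=> x /(_ k I).
apply: (@le_trans _ _ (\sum_(i <oo) diam_pow d (U k i))).
  apply: lee_nneseries => [i *|i _]; first exact: diam_pow_ge0.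
  rewrite /diam_pow diam_closure; case: ifPn => [_|cU].
    by case: ifPn => // _; exact: poweR_ge0.
  by case: ifPn => // /eqP U0; move: cU; rewrite U0 closure0 eqxx.
by apply: (le_trans (HU k).2); rewrite leeD2l// lee_fin ltW.
Qed.

End hulls.

(** * Inner regularity *)

Lemma nonincreasing_measure_lt dd (T : algebraOfSetsType dd) (R : realType)
    (mu : {measure set T -> \bar R}) (F : (set T)^nat) (e : \bar R) :
    (mu (F 0%N) < +oo)%E -> (forall i, measurable (F i)) ->
    measurable (\bigcap_i F i) -> (forall i, F i.+1 `<=` F i) ->
    (mu (\bigcap_i F i) < e)%E ->
  exists i, (mu (F i) < e)%E.
Proof.
move=> F0 mF mI dF Fe; apply: contrapT => /forallNP H.
have ni : nonincreasing_seq F.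
  by apply/nonincreasing_seqP => i; exact/subsetPset.
have cv := nonincreasing_cvg_mu F0 mF mI ni.
suff : (e <= mu (\bigcap_i F i))%E by rewrite leNgt Fe.
by apply: (cvge_to_ge cv); apply: nearW => i; rewrite leNgt; apply/negP; exact: H.
Qed.

Section inner_regularity.
Context {R : realType} {n : nat} (d : R) (E : set 'rV[R]_n).
Hypothesis d0 : 0 < d.
Hypothesis mE : (hausdorff d).-cara.-measurable E.
Hypothesis Eoo : (hausdorff d E < +oo)%E.
Local Open Scope ereal_scope.
Implicit Types (A L : set 'rV[R]_n).

Let d0' : (0 <= d)%R. Proof. exact: ltW. Qed.

(** The error is measured by the trace of Hausdorff measure on [E], which is a
    finite measure, although Hausdorff measure itself is not even sigma-finite. *)
Definition inner_regular A := (hausdorff d).-cara.-measurable A /\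
  forall e : R, (0 < e)%R ->
    exists L, [/\ compact L, L `<=` A & hausdorff d (E `&` (A `\` L)) < e%:E].

Lemma compact_measurable L : compact L -> (hausdorff d).-cara.-measurable L.
Proof.
move=> cL; apply: hausdorff_closed_measurable => //.
by apply: compact_closed cL; exact: norm_hausdorff.
Qed.

Let inner_regular_seq (A : (set 'rV[R]_n)^nat) (e : R) : (0 < e)%R ->
    (forall k, inner_regular (A k)) ->
  exists L : (set 'rV[R]_n)^nat, [/\ forall k, compact (L k),
    forall k, L k `<=` A k &
    \sum_(k <oo) hausdorff d (E `&` (A k `\` L k)) <= e%:E].
Proof.
move=> e0 rA.
have ek k : (0 < e / (2 ^ k.+1)%:R)%R by rewrite divr_gt0// ltr0n expn_gt0.
have [L HL] := choice (fun k => (rA k).2 _ (ek k)).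
exists L; split; [by move=> k; case: (HL k)|by move=> k; case: (HL k)|].
apply: le_trans (epsilon_trick0 xpredT (ltW e0)).
apply: lee_nneseries => [k *|k _]; first exact: hausdorff_ge0.
by apply: ltW; case: (HL k).
Qed.

Let half_lt (e : R) : (0 < e)%R -> ((e / 2)%:E < e%:E).
Proof. by move=> e0; rewrite lte_fin ltr_pdivrMr// ltr_pMr// ltr1n. Qed.

Lemma inner_regular_bigcap (A : (set 'rV[R]_n)^nat) :
  (forall k, inner_regular (A k)) -> inner_regular (\bigcap_k A k).
Proof.
move=> rA; split; first by apply: bigcapT_measurable => k; exact: (rA k).1.
move=> e e0; have e20 : (0 < e / 2)%R by rewrite divr_gt0.
have [L [cL LA Le]] := inner_regular_seq e20 rA.
exists (\bigcap_k L k); split.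
- apply: (subclosed_compact _ (cL 0%N)); last by move=> x; exact.
  by apply: closed_bigI => k _; apply: compact_closed; [exact: norm_hausdorff|].
- by move=> x Lx k _; apply: LA; exact: Lx.
- apply: le_lt_trans (half_lt e0); apply: le_trans Le.
  apply: le_trans (outer_measure_sigma_subadditive _ _).
  apply: le_outer_measure => x [Ex [Ax /existsNP[k /not_implyP[_ Lx]]]].
  by exists k => //; split => //; split => //; exact: Ax.
Qed.

(** A finite union of compact sets is enough, by continuity from above of the
    finite trace on [E]. *)
Lemma inner_regular_bigcup (A : (set 'rV[R]_n)^nat) :
  (forall k, inner_regular (A k)) -> inner_regular (\bigcup_k A k).
Proof.
move=> rA; have mA : (hausdorff d).-cara.-measurable (\bigcup_k A k).
  by apply: bigcupT_measurable => k; exact: (rA k).1.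
split => // e e0; have e20 : (0 < e / 2)%R by rewrite divr_gt0.
have [L [cL LA Le]] := inner_regular_seq e20 rA.
pose K m := \big[setU/set0]_(k < m) L k.
have cK m : compact (K m) by apply: bigsetU_compact => i _.
pose F m := E `&` (\bigcup_k A k `\` K m).
have mF m : (hausdorff d).-cara.-measurable (F m).
  by apply: measurableI => //; apply: measurableD => //; exact: compact_measurable.
have [|||||m Fm] := @nonincreasing_measure_lt _ _ R (hausdorff_measure n d) F e%:E.
- by apply: le_lt_trans Eoo; apply: le_outer_measure => x [].
- exact: mF.
- exact: bigcapT_measurable.
- move=> m x [Ex [Ax Kx]]; split => //; split => //; apply: contra_not Kx.
  by rewrite /K big_ord_recr/=; left.
- apply: le_lt_trans (half_lt e0); apply: le_trans Le.
  apply: le_trans (outer_measure_sigma_subadditive _ _).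
  apply: le_outer_measure => x Fx.
  have [Ex [[k _ Ax] _]] := Fx 0%N I.
  exists k => //; split => //; split => // Lx.
  have [_ [_]] := Fx k.+1 I; apply.
  by rewrite /K big_ord_recr/=; right.
exists (K m); split => // x; rewrite /K -bigcup_mkord => -[k _ Lx].
by exists k => //; exact: LA.
Qed.

Lemma inner_regular_compact A : compact A -> inner_regular A.
Proof.
move=> cA; split; first exact: compact_measurable.
move=> e e0; exists A; split => //.
by rewrite setDv setI0 outer_measure0 lte_fin.
Qed.

Lemma inner_regular_closed A : closed A -> inner_regular A.
Proof.
move=> cA; rewrite (_ : A = \bigcup_k (A `&` [set x | `|x| <= k%:R]%R)).
  apply: inner_regular_bigcup => k; apply: inner_regular_compact.
  apply: bounded_closed_compact.
    exists k%:R; split; first exact: num_real.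
    by move=> M kM x [_ /= xk]; rewrite (le_trans xk)// ltW.
  apply: closedI => //.
  apply: (@preimage_closed _ _ (fun x : 'rV[R]_n => `|x|%R) [set t : R | (t <= k%:R)%R]).
    by move=> x _; exact: norm_continuous.
  exact: closed_le.
apply/seteqP; split => [x Ax|x [k _ []]//].
exists (Num.truncn `|x|).+1 => //; split => //=.
by apply: ltW; exact: truncnS_gt.
Qed.

(** An open set is the union over [k] of the closed sets formed by the points
    whose ball of radius [k.+1%:R^-1] stays inside. *)
Lemma inner_regular_open A : open A -> inner_regular A.
Proof.
move=> oA.
rewrite (_ : A = \bigcup_k [set x | ball x (k.+1%:R^-1)%R `<=` A]).
  apply: inner_regular_bigcup => k; apply: inner_regular_closed.
  rewrite -(setCK (mkset _)) closedC openE => x /existsNP[y /not_implyP[xy Ay]].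
  have : nbhs x (ball y (k.+1%:R^-1)%R).
    by apply: open_nbhs_nbhs; split; [exact: ball_open|exact: ball_sym].
  apply: filterS => z yz /(_ y) H; apply: Ay; apply: H; exact: ball_sym.
apply/seteqP; split => [x Ax|x [k _]].
  have /nbhs_ballP[e /= e0 eA] : nbhs x A by exact: open_nbhs_nbhs.
  have [k _ /(_ k (leqnn _)) /= ke] := near_infty_natSinv_lt (PosNum e0).
  by exists k => //= y xy; apply: eA; apply: le_ball xy; exact: ltW.
by apply; apply: ballxx; rewrite invr_gt0.
Qed.

Lemma inner_regular_hull s : inner_regular (coded_hull s).
Proof.
apply: inner_regular_bigcap => k; apply: inner_regular_bigcup => i.
apply: inner_regular_closed; rewrite closedC; apply: bigcup_open => pq _.
exact: open_rat_box.
Qed.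

Lemma inner_regular_hullC s : inner_regular (~` coded_hull s).
Proof.
rewrite setC_bigcap; apply: inner_regular_bigcup => k.
rewrite setC_bigcup; apply: inner_regular_bigcap => i.
rewrite setCK; apply: inner_regular_open; apply: bigcup_open => pq _.
exact: open_rat_box.
Qed.

(** The set [E] is not assumed to be Borel. A hull [G] of [E] exceeds [E] by a
    null set, which has a null hull [G']; then [G `\` G'] is contained in [E],
    exhausts it up to a null set, and is obtained from open and closed sets by
    countable unions and intersections. *)
Lemma hausdorff_compact_approx (e : R) : (0 < e)%R ->
  exists L, [/\ compact L, L `<=` E & hausdorff d (E `\` L) < e%:E].
Proof.
move=> e0; have [s [Es sE]] := hausdorff_hull d0 Eoo.
have null : hausdorff d (coded_hull s `\` E) = 0.
  have : hausdorff d (coded_hull s) =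
      hausdorff d (coded_hull s `&` E) + hausdorff d (coded_hull s `&` ~` E).
    exact: mE.
  rewrite setIidr// => H; apply/eqP; rewrite eq_le hausdorff_ge0 andbT.
  have Efin : hausdorff d E \is a fin_num by rewrite ge0_fin_numE ?hausdorff_ge0.
  by rewrite -(leeD2lE _ _ Efin) adde0 -H.
have [|t [Nt tN]] := @hausdorff_hull R n d (coded_hull s `\` E) d0.
  by rewrite null.
have {tN} tnull : hausdorff d (coded_hull t) = 0.
  by apply/eqP; rewrite eq_le hausdorff_ge0 andbT -null.
(* The alternating sequence encodes a binary intersection as a countable one. *)
have reg : inner_regular (coded_hull s `&` ~` coded_hull t).
  have -> : coded_hull s `&` ~` coded_hull t =
      \bigcap_k (if k is 0%N then coded_hull s else ~` coded_hull t)
      :> set 'rV[R]_n.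
    apply/seteqP; split => [x [xs xt] [|k] _//|x H].
    by split; [exact: (H 0%N I)|exact: (H 1%N I)].
  apply: inner_regular_bigcap => -[|k]; first exact: inner_regular_hull.
  exact: inner_regular_hullC.
have [L [cL LA Le]] := reg.2 e e0.
exists L; split => //.
  move=> x /LA[xs xt]; apply: contrapT => Ex; apply: xt; apply: Nt.
  by split.
apply: le_lt_trans Le.
apply: (@le_trans _ _ (hausdorff d ((E `&` ((coded_hull s `&` ~` coded_hull t) `\` L))
   `|` coded_hull t))).
  apply: le_outer_measure => x [Ex Lx].
  have [xt|xt] := pselect (coded_hull t x); first by right.
  by left; split => //; split => //; split => //; exact: Es.
apply: le_trans (outer_measureU2 _ _ _) _.
by rewrite [X in _ + X](_ : _ = 0) ?adde0//; exact: tnull.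
Qed.

End inner_regularity.

(** * Disjoint Cantor sets of positive finite measure *)

Section cantor_ratio.
Context {R : realType}.

(** With [M] choices per coordinate, [M ^ n] cells of relative size [rho] have
    the cost [M ^ n * rho `^ d = 1] of the whole. Because [d < n], the ratio
    [rho = M `^ (- (n / d))] is much smaller than [1 / M] for large [M]; this
    leaves room for twice as many digits. *)
Lemma cantor_ratio (n : nat) (d : R) : 0 < d -> d < n%:R ->
  exists M (rho : R), [/\ (1 < M)%N, 0 < rho, (M.*2)%:R * rho < 1 &
    rho `^ d = (M%:R ^+ n)^-1].
Proof.
move=> d0 dn; pose g : R := n%:R / d - 1.
have g0 : 0 < g by rewrite subr_gt0 ltr_pdivlMr// mul1r.
pose M := (Num.truncn ((2 : R) `^ g^-1)).+1.
have M0 : 0 < M%:R :> R by rewrite ltr0n.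
(* [M%:R * rho] equals [M%:R `^ (- g)]. *)
have Mg : 2 < M%:R `^ g :> R.
  have -> : 2 = ((2 : R) `^ g^-1) `^ g :> R.
    by rewrite -powRrM mulVf ?gt_eqF// powRr1.
  by apply: gt0_ltr_powR; rewrite ?nnegrE ?powR_ge0//; exact: truncnS_gt.
exists M, (M%:R `^ (- (n%:R / d))); split => //.
- rewrite ltnS truncn_gt0 -[leLHS](powRr0 2); apply: ler_powR.
    by rewrite ler1n.
  by rewrite invr_ge0 ltW.
- exact: powR_gt0.
- have -> : - (n%:R / d) = - 1 - g :> R by rewrite /g; lra.
  rewrite powRB ?(gt_eqF M0) ?implybT// powR_inv1 ?(ltW M0)//.
  rewrite -mul2n natrM !mulrA mulfK ?gt_eqF//.
  by rewrite ltr_pdivrMr ?mul1r// (lt_trans _ Mg).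
- by rewrite -powRrM mulNr divfK ?gt_eqF// powR_invn// ltW.
Qed.

End cantor_ratio.

Section base_digits.
Context {R : realType} (M : nat).
Hypothesis M0 : (0 < M)%N.
Implicit Types u v : R.

Definition base_digit (m : nat) u : nat := Num.truncn (M%:R ^+ m.+1 * u) %% M.

Lemma base_digit_lt m u : (base_digit m u < M)%N.
Proof. by rewrite ltn_mod. Qed.

Let Mx0 m : 0 < M%:R ^+ m :> R. Proof. by rewrite exprn_gt0// ltr0n. Qed.

Lemma truncn_base_digit m u : 0 <= u -> Num.truncn (M%:R ^+ m.+1 * u) =
  (Num.truncn (M%:R ^+ m * u) * M + base_digit m u)%N.
Proof.
move=> u0; rewrite [LHS](divn_eq _ M); congr (_ * M + _)%N; apply/eqP.
set t := M%:R ^+ m * u; have t0 : 0 <= t by rewrite mulr_ge0// ltW.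
have tE : M%:R ^+ m.+1 * u = t * M%:R by rewrite exprSr mulrAC.
have tM0 : 0 <= t * M%:R by rewrite mulr_ge0.
rewrite eq_sym truncn_eq// tE; apply/andP; split.
  rewrite -(ler_pM2r (_ : 0 < M%:R)) ?ltr0n// -natrM.
  by rewrite -truncn_ge_nat// leq_divM.
rewrite -(ltr_pM2r (_ : 0 < M%:R)) ?ltr0n// -natrM -truncn_lt_nat//.
exact: ltn_ceil.
Qed.

Lemma base_digit_close k u v : 0 <= u < 1 -> 0 <= v < 1 ->
    (forall m, (m < k)%N -> base_digit m u = base_digit m v) ->
  `|u - v| <= (M%:R ^+ k)^-1.
Proof.
move=> /andP[u0 u1] /andP[v0 v1] uv.
have : Num.truncn (M%:R ^+ k * u) = Num.truncn (M%:R ^+ k * v).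
  elim: k uv => [|k IH] uv.
    have t01 w : 0 <= w < 1 -> Num.truncn (M%:R ^+ 0 * w) = 0%N.
      by rewrite expr0 mul1r => ?; apply: truncn_def; rewrite mulr1n.
    by rewrite !t01 ?u0 ?v0.
  rewrite !truncn_base_digit// uv// IH// => m mk; apply: uv.
  exact: ltn_trans mk _.
have := truncn_itv (mulr_ge0 (ltW (Mx0 k)) u0).
have := truncn_itv (mulr_ge0 (ltW (Mx0 k)) v0).
move=> + + E; rewrite E -natr1 => /andP[a1 a2] /andP[b1 b2].
rewrite -(ler_pM2l (Mx0 k)) mulfV ?gt_eqF// -[X in X * _](gtr0_norm (Mx0 k)).
by rewrite -normrM mulrBr ler_norml; apply/andP; split; lra.
Qed.

End base_digits.

Section closed_sup_ball.
Context {R : realType} {n : nat}.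
Local Open Scope ereal_scope.

Definition closed_sup_ball (c : 'rV[R]_n) (r : R) : set 'rV[R]_n :=
  [set x | forall j, (`|x ord0 j - c ord0 j| <= r)%R].

Lemma closed_closed_sup_ball c r : closed (closed_sup_ball c r).
Proof.
rewrite (_ : closed_sup_ball c r = \bigcap_(j in [set: 'I_n])
    ((fun x : 'rV[R]_n => x ord0 j) @^-1`
      [set t : R | (`|t - c ord0 j| <= r)%R])).
  apply: closed_bigI => j _; apply: preimage_closed.
    by move=> x _; exact: (@coord_continuous R 1 n ord0 j).
  rewrite (_ : [set t | _] = `[(c ord0 j - r)%R, (c ord0 j + r)%R]%classic).
    exact: interval_closed.
  by apply/seteqP; split => t; rewrite /= in_itv/= ler_distl.
by apply/seteqP; split => [x xc j _|x xc j]; [exact: xc|exact: (xc j I)].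
Qed.

Lemma diam_closed_sup_ball c r : (0 <= r)%R ->
  diam (closed_sup_ball c r) <= (n%:R * (2 * r))%:E.
Proof.
move=> r0; apply: diam_le => x y xc yc; rewrite lee_fin.
apply: eucl_dist_le => [|j]; first by rewrite mulr_ge0.
have := xc j; have := yc j; rewrite !ler_distl => /andP[? ?] /andP[? ?].
by apply/andP; split; lra.
Qed.

End closed_sup_ball.

Section cantor_family.
Context {R : realType} {n : nat} {M : nat} {d rho : R}.
Hypotheses (n0 : (0 < n)%N) (d0 : 0 < d).
Hypotheses (M1 : (1 < M)%N) (rho0 : 0 < rho) (Mrho : (M.*2)%:R * rho < 1).
Hypothesis rhod : rho `^ d = (M%:R ^+ n)^-1.
Let M0 : (0 < M)%N. Proof. exact: ltnW. Qed.
Implicit Types (e : 'I_n -> nat -> nat) (s : nat -> bool) (k : nat).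

(** The tag [s] is written in the parities of the digits; this is what makes the
    Cantor sets of different tags disjoint. *)
Definition tagged_digits s (a : nat -> nat) (i : nat) : nat := ((a i).*2 + s i)%N.

Lemma tagged_digits_lt s (a : nat -> nat) : (forall i, (a i < M)%N) ->
  forall i, (tagged_digits s a i < M.*2)%N.
Proof.
move=> aM i; rewrite /tagged_digits; have := aM i; rewrite -leq_double doubleS.
by apply: leq_trans; rewrite -addnS -addn2 leq_add2l; case: (s i).
Qed.

Lemma tagged_digits_inj s s' (a a' : nat -> nat) i :
  tagged_digits s a i = tagged_digits s' a' i -> a i = a' i /\ s i = s' i.
Proof.
move=> E; have := congr1 odd E; have := congr1 half E.
rewrite /tagged_digits ![((_).*2 + _)%N]addnC !half_bit_double !oddD !odd_double.
by rewrite !addbF !oddb.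
Qed.

Definition cantor_point s e : 'rV[R]_n :=
  \row_j expansion rho (tagged_digits s (e j)).

(** The cell of the points whose first [k] digits are given by [w]; its centre
    has the digits [0] from index [k] on. *)
Definition cantor_box k s (w : {ffun 'I_n * 'I_k -> 'I_M}) : set 'rV[R]_n :=
  closed_sup_ball (cantor_point s (fun j i =>
    if insub i is Some i' then val (w (j, i')) else 0%N)) ((M.*2)%:R * rho ^+ k).

(** Described from outside, by finite unions of cells, which makes it closed
    without a compactness argument. *)
Definition cantor_set s : set 'rV[R]_n :=
  \bigcap_k \bigcup_(w in [set: {ffun 'I_n * 'I_k -> 'I_M}]) cantor_box s w.

Let word_lt k (w : {ffun 'I_n * 'I_k -> 'I_M}) j i :
  ((if insub i is Some i' then val (w (j, i')) else 0%N) < M)%N.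
Proof. by case: insubP => // i' _ _; exact: ltn_ord. Qed.

Lemma cantor_point_set s e : (forall j i, (e j i < M)%N) ->
  cantor_set s (cantor_point s e).
Proof.
move=> eM k _.
exists [ffun ji => Ordinal (eM ji.1 (val ji.2))] => // j.
rewrite !mxE; apply: expansion_dist_le => // [||i ik].
- exact: tagged_digits_lt.
- by apply: tagged_digits_lt => i; exact: word_lt.
- by rewrite /tagged_digits insubT ffunE.
Qed.

Lemma closed_cantor_set s : closed (cantor_set s).
Proof.
apply: closed_bigI => k _; apply: closed_bigcup; first exact: finite_finset.
by move=> w _; exact: closed_closed_sup_ball.
Qed.

(** If the tags differ at the index [i], the centres of the cells of the two
    sets are at a distance bounded below in terms of [i] only, at every level
    [k]; a common point would bring centres of level [k] arbitrarily close. *)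
Lemma cantor_set_disjoint s s' x : cantor_set s x -> cantor_set s' x -> s = s'.
Proof.
move=> xs xs'; apply/funext => i; apply: contrapT => ss'.
have c0 : 0 < (1 - (M.*2)%:R * rho) * rho ^+ i.
  by rewrite mulr_gt0 ?subr_gt0// exprn_gt0.
suff : exists k, 2 * ((M.*2)%:R * rho ^+ k) < (1 - (M.*2)%:R * rho) * rho ^+ i.
  move=> [k ki]; have [w _ xw] := xs k I; have [w' _ xw'] := xs' k I.
  pose j := Ordinal n0; have := xw j; have := xw' j; rewrite !mxE.
  set a := tagged_digits s _; set a' := tagged_digits s' _ => h' h.
  have aM : forall i, (a i < M.*2)%N.
    by apply: tagged_digits_lt => i'; exact: word_lt.
  have aM' : forall i, (a' i < M.*2)%N.
    by apply: tagged_digits_lt => i'; exact: word_lt.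
  suff aa' : `|expansion rho a - expansion rho a'| <= 2 * ((M.*2)%:R * rho ^+ k).
    have := expansion_dist_lt rho0 Mrho aM aM' (le_lt_trans aa' ki).
    by move=> /(_ i (leqnn _))/tagged_digits_inj[_].
  rewrite -[_ - _](subrKA (x ord0 j)) (le_trans (ler_normD _ _))// distrC; lra.
have b0 : 0 < 2 * (M.*2)%:R :> R.
  by rewrite mulr_gt0// ltr0n double_gt0.
have rho1 : `|rho| < 1.
  rewrite gtr0_norm// (le_lt_trans _ Mrho)// ler_peMl ?(ltW rho0)//.
  by rewrite ler1n double_gt0.
have := cvg_expr rho1 => /cvgrPdist_lt/(_ (((1 - (M.*2)%:R * rho) * rho ^+ i)
  / (2 * (M.*2)%:R))).
case; first by rewrite divr_gt0.
move=> k _ /(_ k (leqnn _)); rewrite sub0r normrN ger0_norm ?exprn_ge0 ?(ltW rho0)//.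
by rewrite ltr_pdivlMr// => H; exists k; rewrite mulrA mulrC.
Qed.

Let powR_rhoX k : (rho ^+ k) `^ d = (M%:R ^+ (n * k))^-1.
Proof.
by rewrite -powR_mulrn ?(ltW rho0)// powRAC rhod powR_mulrn// -exprVn -exprM exprVn.
Qed.

Lemma hausdorff_pre_finite_cover (T : finType) (F : T -> set 'rV[R]_n)
    (delta c : R) (A : set 'rV[R]_n) :
    A `<=` \bigcup_(t in [set: T]) F t ->
    (forall t, diam (F t) <= delta%:E)%E ->
    (forall t, diam_pow d (F t) <= c%:E)%E ->
  (hausdorff_pre d delta A <= (#|T|%:R * c)%:E)%E.
Proof.
move=> AF Fd Fc.
pose U i := if insub i is Some i' then F (enum_val (i' : 'I_#|T|)) else set0.
apply: (@le_trans _ _ (\sum_(i <oo) diam_pow d (U i))%E).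
  apply: ereal_inf_lbound; exists U => //; split.
    by move=> i; rewrite /U; case: insubP => // _; rewrite diam0 leNye.
  move=> x /AF[t _ Ft]; exists (enum_rank t) => //.
  by rewrite /U valK enum_rankK.
rewrite (nneseries_split _ #|T|)//; last by move=> *; exact: diam_pow_ge0.
rewrite add0n [X in (_ + X)%E]eseries0 ?adde0; last first.
  by move=> i Ti _; rewrite /U insubN ?diam_pow0// -leqNgt.
rewrite big_mkord (_ : _%:E = \sum_(i < #|T|) c%:E)%E; last first.
  by rewrite sumEFin sumr_const card_ord mulr_natl.
by apply: lee_sum => i _; rewrite /U valK.
Qed.

Let sup_ball_pow_le k s (w : {ffun 'I_n * 'I_k -> 'I_M}) :
  (diam_pow d (cantor_box s w) <=
   ((n%:R * (2 * (M.*2)%:R)) `^ d * (M%:R ^+ (n * k))^-1)%:E)%E.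
Proof.
have c0 : 0 <= n%:R * (2 * (M.*2)%:R) :> R by rewrite !mulr_ge0.
have [->|/set0P B0] := eqVneq (cantor_box s w) set0.
  by rewrite diam_pow0 lee_fin mulr_ge0 ?powR_ge0// invr_ge0 exprn_ge0.
have r0 : 0 <= (M.*2)%:R * rho ^+ k by rewrite mulr_ge0// exprn_ge0// ltW.
rewrite /diam_pow ifN; last exact/set0P.
apply: (@le_trans _ _ (poweR (n%:R * (2 * ((M.*2)%:R * rho ^+ k)))%:E d)).
  apply: gt0_ler_poweR; rewrite ?in_itv/= ?andbT ?leey ?diam_ge0 ?(ltW d0)//.
    by rewrite lee_fin !mulr_ge0// exprn_ge0// ltW.
  exact: diam_closed_sup_ball.
rewrite poweR_EFin lee_fin -powR_rhoX -powRM ?exprn_ge0 ?(ltW rho0)//.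
by rewrite !mulrA.
Qed.

(** The cells of level [k] form a cover whose cost does not depend on [k], as
    [M ^ n * rho `^ d = 1]. *)
Lemma cantor_set_finite s : (hausdorff d (cantor_set s) < +oo)%E.
Proof.
apply: (@le_lt_trans _ _ ((n%:R * (2 * (M.*2)%:R)) `^ d)%:E); last exact: ltry.
apply: ge_ereal_sup => _ [delta /= delta0 <-].
have b0 : 0 < n%:R * (2 * (M.*2)%:R) :> R.
  by rewrite !mulr_gt0// ltr0n// double_gt0.
have rho1 : `|rho| < 1.
  rewrite gtr0_norm// (le_lt_trans _ Mrho)// ler_peMl ?(ltW rho0)//.
  by rewrite ler1n double_gt0.
have := cvg_expr rho1 => /cvgrPdist_lt/(_ (delta / (n%:R * (2 * (M.*2)%:R)))).
case; first by rewrite divr_gt0.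
move=> k _ /(_ k (leqnn _)); rewrite sub0r normrN ger0_norm ?exprn_ge0 ?(ltW rho0)//.
rewrite ltr_pdivlMr// => kdelta.
apply: le_trans (hausdorff_pre_finite_cover
  (F := fun w : {ffun 'I_n * 'I_k -> 'I_M} => cantor_box s w)
  (c := (n%:R * (2 * (M.*2)%:R)) `^ d * (M%:R ^+ (n * k))^-1) _ _ _) _.
- by move=> x /(_ k I).
- move=> w; apply: le_trans (diam_closed_sup_ball _ _) _.
    by rewrite mulr_ge0// exprn_ge0// ltW.
  by rewrite lee_fin (le_trans _ (ltW kdelta))// !mulrA mulrC !mulrA.
- by move=> w; exact: sup_ball_pow_le.
- rewrite lee_fin card_ffun card_prod !card_ord mulrCA natrX mulfV ?mulr1//.
  by rewrite expf_neq0// pnatr_eq0 -lt0n.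
Qed.

Let c : R := 1 - (M.*2)%:R * rho.
Let c0 : 0 < c. Proof. by rewrite subr_gt0. Qed.

(** Digit [m] of [u] in base [M] becomes digit [m %/ n] of the coordinate
    [m %% n], so that [n * k] digits of [u] correspond to one cell of level [k]. *)
Let unit_point s (u : R) : 'rV[R]_n :=
  cantor_point s (fun j i => base_digit M (n * i + j) u).

(** Two points closer than the gap of level [k] come from numbers with the same
    first [n * k.+1] digits in base [M], and [M ^ (- n * k) = (rho ^ k) `^ d]. *)
Let unit_point_holder s (u v : R) : 0 <= u < 1 -> 0 <= v < 1 ->
  `|u - v| <= (eucl_dist (unit_point s u) (unit_point s v) / c) `^ d.
Proof.
move=> u01 v01; set t := eucl_dist _ _.
have t0 : 0 <= t := eucl_dist_ge0 _ _.
have agree k : t < c * rho ^+ k -> `|u - v| <= (M%:R ^+ (n * k.+1))^-1.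
  move=> tk; apply: base_digit_close => // m mk.
  have mn : (m %% n < n)%N by rewrite ltn_mod.
  have := eucl_dist_coord (unit_point s u) (unit_point s v) (Ordinal mn).
  rewrite -/t !mxE => /le_lt_trans/(_ tk).
  move=> /(expansion_dist_lt rho0 Mrho)-/(_ _ _ (m %/ n)%N) H.
  have /tagged_digits_inj[] :
      tagged_digits s (fun i => base_digit M (n * i + Ordinal mn) u) (m %/ n)%N =
      tagged_digits s (fun i => base_digit M (n * i + Ordinal mn) v) (m %/ n)%N.
    apply: H.
    - by apply: tagged_digits_lt => i; exact: base_digit_lt.
    - by apply: tagged_digits_lt => i; exact: base_digit_lt.
    - by rewrite -ltnS ltn_divLR// mulnC.
  by rewrite /= mulnC -divn_eq.
have [uv|uv] := eqVneq u v; first by rewrite uv subrr normr0 powR_ge0.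
have exk : exists k, c * rho ^+ k <= t.
  apply: contrapT => /forallNP H.
  have uv0 : 0 < `|u - v| by rewrite normr_gt0 subr_eq0.
  have [k _ /(_ k (leqnn _)) /= ke] := near_infty_natSinv_lt (PosNum uv0).
  have /agree : t < c * rho ^+ k by rewrite ltNge; apply/negP; exact: H.
  apply/negP; rewrite -ltNge; apply: le_lt_trans ke.
  rewrite lef_pV2 ?posrE ?exprn_gt0 ?ltr0n// -natrX ler_nat.
  apply: leq_trans (ltn_expl k M1) _.
  by rewrite leq_exp2l// (leq_trans (leqnSn k))// leq_pmull.
case: (ex_minnP exk) => -[|k] kt kmin.
  apply: (@le_trans _ _ 1).
    by case/andP: u01 => ? ?; case/andP: v01 => ? ?; rewrite ler_norml; apply/andP; split; lra.
  apply: (@le_trans _ _ (1 `^ d)); first by rewrite powR1.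
  apply: ge0_ler_powR; rewrite ?nnegrE ?(ltW d0)//.
    by rewrite divr_ge0// ltW.
  by rewrite ler_pdivlMr// mul1r; move: kt; rewrite expr0 mulr1.
apply: (@le_trans _ _ (M%:R ^+ (n * k.+1))^-1).
  by apply: agree; rewrite ltNge; apply/negP => /kmin; rewrite ltnn.
rewrite -powR_rhoX; apply: ge0_ler_powR; rewrite ?nnegrE ?(ltW d0)//.
- by rewrite exprn_ge0// ltW.
- by rewrite divr_ge0// ltW.
- by rewrite ler_pdivlMr// mulrC.
Qed.

(** Mass distribution principle: through [unit_point], which has an inverse with
    Hoelder exponent [d], a cover of the Cantor set becomes a cover of the unit
    interval by intervals of length at most a constant times [diam `^ d], so
    Lebesgue measure bounds the cost from below. *)
Lemma cantor_set_gt0 s : (0 < hausdorff d (cantor_set s))%E.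
Proof.
(* The factor [2] allows for intervals centred at one of their points. *)
pose C : R := 2 * (c^-1) `^ d.
have C0 : 0 < C by rewrite mulr_gt0// powR_gt0// invr_gt0.
have C'0 : 0 < C^-1 by rewrite invr_gt0.
apply: (@lt_le_trans _ _ C^-1%:E); first by rewrite lte_fin.
apply: le_trans (hausdorff_pre_le _ _ (@ltr01 R)).
apply: le_ereal_inf_tmp => _ [U [U1 KU] <-].
rewrite -[leLHS]mule1 lee_pdivrMl//.
have HI i : exists I : set R, [/\ measurable I,
    (forall u, 0 <= u < 1 -> U i (unit_point s u) -> I u) &
    (lebesgue_measure I <= C%:E * diam_pow d (U i))%E].
  have [[u0 [u01 Uu]]|none] :=
      pselect (exists u, 0 <= u < 1 /\ U i (unit_point s u)); last first.
    exists set0; split => //; first by move=> u u1 Uu; apply: none; exists u.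
    by rewrite measure0 mule_ge0 ?diam_pow_ge0// lee_fin ltW.
  have U0 : U i !=set0 by exists (unit_point s u0).
  have Ufin : diam (U i) \is a fin_num.
    by rewrite ge0_fin_numE ?diam_ge0// (le_lt_trans (U1 i))// ltry.
  pose t := fine (diam (U i)); have tE : diam (U i) = t%:E by rewrite fineK.
  have t0 : 0 <= t by rewrite -lee_fin -tE diam_ge0.
  pose r := (t / c) `^ d; have r0 : 0 <= r by exact: powR_ge0.
  exists `[u0 - r, u0 + r]%classic; split => //.
    move=> u u1 Uu'; rewrite /= in_itv/= -ler_distl.
    apply: (le_trans (unit_point_holder s u1 u01)).
    apply: ge0_ler_powR; rewrite ?nnegrE ?(ltW d0)//.
    - by rewrite divr_ge0// ?(ltW c0)// eucl_dist_ge0.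
    - by rewrite divr_ge0// ltW.
    - rewrite ler_pM2r ?invr_gt0// -lee_fin -tE.
      exact: eucl_dist_le_diam.
  have CE : C * t `^ d = 2 * r.
    by rewrite /C /r powRM// ?invr_ge0 ?(ltW c0)// -!mulrA [X in 2 * X]mulrC.
  rewrite /diam_pow ifN; last exact/set0P.
  rewrite tE poweR_EFin -EFinM CE lebesgue_measure_itv/= lte_fin.
  case: ifPn => _; last by rewrite lee_fin mulr_ge0.
  by rewrite -EFinB lee_fin; lra.
have [I HI'] := choice HI.
have : (lebesgue_measure (`[0%R, 1%R[%classic : set R) <=
        \sum_(i <oo) lebesgue_measure (I i))%E.
  apply: measure_sigma_subadditive => //.
    by move=> i; have [] := HI' i.
  move=> u /=; rewrite in_itv/= => u01.
  have [|i _ Uu] := KU (unit_point s u).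
    by apply: cantor_point_set => j i; exact: base_digit_lt.
  by exists i => //; have [_ H _] := HI' i; exact: H.
rewrite lebesgue_measure_itv/= lte_fin ltr01 oppr0 adde0 => /le_trans; apply.
rewrite -nneseriesZl; last by move=> *; exact: diam_pow_ge0.
apply: lee_nneseries => [i *|i _]; first exact: measure_ge0.
by have [] := HI' i.
Qed.

End cantor_family.

Lemma hausdorff_disjoint_family (R : realType) (n : nat) (d : R) :
    (0 < n)%N -> 0 < d -> d < n%:R ->
  exists K : (nat -> bool) -> set 'rV[R]_n, [/\ forall s, closed (K s),
    forall s s' x, K s x -> K s' x -> s = s' &
    forall s, (0 < hausdorff d (K s) < +oo)%E].
Proof.
move=> n0 d0 dn; have [M [rho [M1 rho0 Mrho rhod]]] := cantor_ratio d0 dn.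
exists (@cantor_set R n M rho); split.
- exact: closed_cantor_set.
- exact: (cantor_set_disjoint n0 M1 rho0 Mrho).
- move=> s; rewrite (cantor_set_gt0 n0 d0 M1 rho0 Mrho rhod).
  exact: (cantor_set_finite n0 d0 M1 rho0 Mrho rhod).
Qed.

(** * Distribution functions of diffuse measures *)

Lemma measure_ray_unique (R : realType)
    (m1 m2 : {measure set (measurableTypeR R) -> \bar R}) :
    (forall a : R, m1 `]-oo, a]%classic = m2 `]-oo, a]%classic) ->
    (forall a : R, (m1 `]-oo, a]%classic < +oo)%E) ->
  forall S, measurable S -> m1 S = m2 S.
Proof.
move=> m12 m1oo S mS; pose G := [set A | exists x : R, A = `]-oo, x]%classic].
apply: (@g_sigma_algebra_measure_unique _ R (measurableTypeR R) G _
  (fun k : nat => `]-oo, k%:R]%classic)).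
- by move=> _ [x ->]; exact: measurable_itv.
- by move=> k; exists k%:R.
- apply/seteqP; split => // x _; exists (Num.truncn x).+1 => //=.
  by rewrite in_itv/= ltW// truncnS_gt.
- move=> _ _ [x ->] [y ->]; exists (Order.min x y).
  by apply/seteqP; split => t; rewrite /= !in_itv/= le_min => /andP.
- by move=> _ [x ->]; exact: m12.
- by move=> k; exact: m1oo.
- have : (@ocitv R).-sigma.-measurable S by exact: mS.
  rewrite RGenOInfty.measurableE; apply: smallest_sub.
    exact: smallest_sigma_algebra.
  move=> _ [x ->]; rewrite -setCitvl.
  by apply: sigma_algebraC; apply: sub_sigma_algebra; exists x.
Qed.

Section distribution_function.
Context {R : realType} (nu : {measure set (measurableTypeR R) -> \bar R}).
Local Open Scope ereal_scope.
Hypothesis nu_fin : forall t : R, nu `]-oo, t]%classic < +oo.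
Hypothesis nu_pt : forall t : R, nu [set t] = 0.
Hypothesis nu_neg : nu `]-oo, 0%R[%classic = 0.

Definition distr (t : R) : R := fine (nu `]-oo, t]%classic).
Local Notation F := distr.

Let FE t : (F t)%:E = nu `]-oo, t]%classic.
Proof. by rewrite fineK// ge0_fin_numE// measure_ge0. Qed.

Let F_itv a b : (a <= b)%R -> (F b)%:E = (F a)%:E + nu `]a, b]%classic.
Proof.
move=> ab; rewrite !FE -measureU//.
  by rewrite -itv_bndbnd_setU.
apply/seteqP; split => // x /=; rewrite !in_itv/= => -[xa /andP[ax _]].
by move: xa; rewrite leNgt ax.
Qed.

Lemma distr_nd : {homo F : a b / (a <= b)%R}.
Proof. by move=> a b ab; rewrite -lee_fin (F_itv ab) leeDl// measure_ge0. Qed.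

Lemma distr_ge0 t : (0 <= F t)%R.
Proof. by rewrite -lee_fin FE measure_ge0. Qed.

Lemma distr_le t : (F t)%:E <= nu setT.
Proof. by rewrite FE; apply: le_measure; rewrite ?inE. Qed.

Lemma distr_lt0 t : (t < 0)%R -> F t = 0%R.
Proof.
move=> t0; apply/EFin_inj/eqP; rewrite FE eq_le measure_ge0 andbT.
apply: (@le_trans _ _ (nu `]-oo, 0%R[%classic)); last by rewrite nu_neg.
apply: le_measure; rewrite ?inE// => x /=; rewrite !in_itv/= => /le_lt_trans; exact.
Qed.

(** The intervals [`]t - r, t + r]] decrease to a point, which is null. *)
Lemma distr_cont (t e : R) : (0 < e)%R -> exists2 r : R, (0 < r)%R &
  (F (t + r) < F (t - r) + e)%R.
Proof.
move=> e0; pose r k : R := k.+1%:R^-1%R.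
have r0 k : (0 < r k)%R by rewrite invr_gt0.
have capE : \bigcap_k `](t - r k)%R, (t + r k)%R]%classic = [set t].
  apply/seteqP; split => [x xk|_ -> k _]; last first.
    by rewrite /= in_itv/= ltrBlDr ltrDl r0 lerDl ltW.
  apply/eqP; rewrite eq_le; apply/andP; split; apply/ler_addgt0Pr => y y0.
    have [k _ /(_ k (leqnn _)) /= ky] := near_infty_natSinv_lt (PosNum y0).
    have := xk k I; rewrite /= in_itv/= => /andP[_ /le_trans]; apply.
    by rewrite lerD2l ltW.
  have [k _ /(_ k (leqnn _)) /= ky] := near_infty_natSinv_lt (PosNum y0).
  have := xk k I; rewrite /= in_itv/= ltrBlDr => /andP[/ltW/le_trans + _]; apply.
  by rewrite lerD2l ltW.
have [|||||k ke] := @nonincreasing_measure_lt _ _ R nu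
  (fun k => `](t - r k)%R, (t + r k)%R]%classic) e%:E.
- apply: le_lt_trans (nu_fin (t + r 0%N)%R).
  by apply: le_measure; rewrite ?inE// => x /=; rewrite !in_itv/= => /andP[].
- by [].
- by rewrite capE; exact: measurable_set1.
- move=> k x /=; rewrite !in_itv/= => /andP[h1 h2].
  have rk : (r k.+1 <= r k)%R by rewrite lef_pV2 ?posrE// ler_nat.
  by apply/andP; split; lra.
- by rewrite capE nu_pt lte_fin.
exists (r k) => //; rewrite -lte_fin EFinD (@F_itv (t - r k) (t + r k))%R.
  by rewrite lteD2lE.
by have := r0 k; lra.
Qed.

Lemma continuous_distr : continuous F.
Proof.
move=> t; apply/cvgrPdist_lt => e e0.
have [r r0 Fr] := distr_cont t e0.
apply/nbhs_ballP; exists r => // s; rewrite /ball/= ltr_norml => /andP[ts1 ts2].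
have a1 : (F (t - r) <= F s)%R by apply: distr_nd; lra.
have a2 : (F s <= F (t + r))%R by apply: distr_nd; lra.
have a3 : (F (t - r) <= F t)%R by apply: distr_nd; lra.
have a4 : (F t <= F (t + r))%R by apply: distr_nd; lra.
by rewrite ltr_norml; apply/andP; split; lra.
Qed.

Lemma distr_unbounded (a : R) : a%:E < nu setT -> exists t, (a < F t)%R.
Proof.
move=> anu; apply: contrapT => /forallNP H.
have cv : nu `]-oo, k%:R]%classic @[k --> \oo] --> nu setT.
  have TE : [set: R] = \bigcup_k `]-oo, k%:R]%classic.
    apply/seteqP; split => // x _; exists (Num.truncn x).+1 => //=.
    by rewrite in_itv/= ltW// truncnS_gt.
  rewrite TE; apply: nondecreasing_cvg_mu => //; first by rewrite -TE.
  apply/nondecreasing_seqP => k; apply/subsetPset => x /=.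
  by rewrite !in_itv/= => /le_trans; apply; rewrite ler_nat.
suff : nu setT <= a%:E by rewrite leNgt anu.
apply: (cvge_to_le cv); apply: nearW => k; rewrite -FE lee_fin leNgt.
by apply/negP; exact: H.
Qed.

(** By continuity the value [a] is attained at the largest point where the
    distribution function does not exceed [a]. *)
Lemma distr_quantile (a : R) : (0 <= a)%R -> a%:E < nu setT ->
  exists2 t, F t = a & forall s, (F s <= a)%R = (s <= t)%R.
Proof.
move=> a0 anu; have [u Fu] := distr_unbounded anu.
pose S := [set t | (F t <= a)%R]; pose t := sup S.
have supS : has_sup S.
  split; first by exists (- 1)%R; rewrite /S/= distr_lt0//; lra.
  exists u => x /= xa; rewrite leNgt; apply/negP => ux.
  by have := distr_nd (ltW ux); rewrite leNgt (le_lt_trans xa).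
have ubS s : (F s <= a)%R -> (s <= t)%R.
  by move=> Fs; apply: sup_upper_bound.
have Ft : F t = a.
  apply/eqP; rewrite eq_le; apply/andP; split; rewrite leNgt; apply/negP => H.
    have e0 : (0 < F t - a)%R by rewrite subr_gt0.
    have [r r0 Fr] := distr_cont t e0.
    have [x Fx tx] := sup_adherent r0 supS; rewrite /S/= in Fx.
    have a1 : (F (t - r) <= F x)%R by apply: distr_nd; exact: ltW.
    have a4 : (F t <= F (t + r))%R by apply: distr_nd; lra.
    lra.
  have e0 : (0 < a - F t)%R by rewrite subr_gt0.
  have [r r0 Fr] := distr_cont t e0.
  have a3 : (F (t - r) <= F t)%R by apply: distr_nd; lra.
  suff : (t + r <= t)%R by lra.
  by apply: ubS; lra.
exists t => // s; apply/idP/idP; first exact: ubS.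
by move=> st; rewrite -Ft; exact: distr_nd.
Qed.

(** The interval from [0] to [m], in a form that also makes sense for [m = +oo]. *)
Definition below (m : \bar R) : set R := [set y | (0 <= y)%R /\ y%:E < m].

Lemma below_measurable m : measurable (below m).
Proof.
case: m => [r||].
- rewrite (_ : below _ = `[0%R, r[%classic); first exact: measurable_itv.
  by apply/seteqP; split => y; rewrite /below/= in_itv/= lte_fin => /andP.
- rewrite (_ : below _ = `[0%R, +oo[%classic); first exact: measurable_itv.
  apply/seteqP; split => y; rewrite /below/= in_itv/= andbT; first by case.
  by rewrite ltry.
- rewrite (_ : below _ = set0); first exact: measurable0.
  by apply/seteqP; split => y //= -[].
Qed.

Let distr_ray a : nu [set t | (F t <= a)%R] =
  lebesgue_measure (`]-oo, a]%classic `&` below (nu setT)).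
Proof.
have [a0|a0] := ltrP a 0%R.
  rewrite (_ : [set t | (F t <= a)%R] = set0); last first.
    apply/seteqP; split => // t /=; apply/negP; rewrite -ltNge.
    exact: lt_le_trans a0 (distr_ge0 t).
  rewrite (_ : _ `&` _ = set0) ?measure0//.
  apply/seteqP; split => // t [/=]; rewrite in_itv/= => ta [t0 _].
  by move: a0; rewrite ltNge (le_trans t0).
have [aM|Ma] := ltP a%:E (nu setT).
  have [t Ft tP] := distr_quantile a0 aM.
  rewrite (_ : [set t | (F t <= a)%R] = `]-oo, t]%classic); last first.
    by apply/seteqP; split => s /=; rewrite in_itv/= tP.
  rewrite -FE Ft (_ : _ `&` _ = `[0%R, a]%classic).
    by rewrite lebesgue_measure_itv/= lte_fin; case: ltrP => [_|?];
      [rewrite oppr0 adde0|congr EFin; apply/le_anti/andP].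
  apply/seteqP; split => s; rewrite /= !in_itv/=.
    by move=> [sa [s0 _]]; rewrite s0.
  by move=> /andP[s0 sa]; split => //; split => //; rewrite (le_lt_trans _ aM).
rewrite (_ : [set t | (F t <= a)%R] = setT); last first.
  apply/seteqP; split => // t _ /=; rewrite -lee_fin.
  exact: le_trans (distr_le t) Ma.
have nuE : nu setT = (fine (nu setT))%:E.
  by rewrite fineK// ge0_fin_numE// (le_lt_trans Ma)// ltry.
move: Ma; rewrite nuE lee_fin; set m := fine _ => ma.
rewrite (_ : _ `&` _ = `[0%R, m[%classic).
  have m0 : (0 <= m)%R by rewrite -lee_fin -nuE.
  by rewrite lebesgue_measure_itv/= lte_fin; case: ltrP => [_|?];
      [rewrite oppr0 adde0|congr EFin; apply/le_anti/andP].
apply/seteqP; split => s; rewrite /below/= !in_itv/= lte_fin.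
  by move=> [_ [s0 sm]]; rewrite s0.
move=> /andP[s0 sm]; split => //; rewrite (le_trans (ltW sm))//.
Qed.

(** A sublevel set of the distribution function is a ray that ends at a
    quantile, so its measure is the level: the image measure agrees with
    Lebesgue measure on rays. *)
Lemma distr_lebesgue (S : set R) : measurable S ->
  nu (F @^-1` S) = lebesgue_measure (S `&` below (nu setT)).
Proof.
have mF : measurable_fun [set: measurableTypeR R] (F : _ -> measurableTypeR R).
  exact: continuous_measurable_fun continuous_distr.
move=> mS.
have rayE a : F @^-1` `]-oo, a]%classic = [set t | (F t <= a)%R].
  by apply/seteqP; split => t; rewrite /= in_itv.
pose m1 := measure_function_pushforward__canonical__measure_function_Measure nu mF.
apply: (@measure_ray_unique R m1
  (mrestr lebesgue_measure (below_measurable (nu setT)))) mS.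
  by move=> a; exact: (etrans (congr1 nu (rayE a)) (distr_ray a)).
move=> a; rewrite [X in X < _](_ : _ = nu [set t | (F t <= a)%R]); last first.
  exact: (congr1 nu (rayE a)).
  rewrite distr_ray; apply: (@le_lt_trans _ _ (lebesgue_measure `[0%R, a]%classic)).
    apply: le_measure; rewrite ?inE//.
      by apply: measurableI => //; exact: below_measurable.
    by move=> t [/=]; rewrite !in_itv/= => ta [t0 _]; rewrite t0.
  by rewrite lebesgue_measure_itv/= lte_fin; case: ifPn => // _; rewrite -EFinB ltry.
Qed.

End distribution_function.

(** * Lusin's theorem *)

Section lusin.
Context {R : realType} {n : nat} (d : R).
Hypothesis d0 : 0 < d.
Local Open Scope ereal_scope.
Let X := caratheodory_type (hausdorff (R := R) (n := n) d).
Context (phi : 'rV[R]_n -> R).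
Hypothesis mphi : measurable_fun [set: X] (phi : X -> R).

Let mle (t : R) : (hausdorff d).-cara.-measurable [set x | (phi x <= t)%R].
Proof.
rewrite (_ : [set x | (phi x <= t)%R] = setT `&` phi @^-1` `]-oo, t]%classic).
  exact: mphi.
by rewrite setTI; apply/seteqP; split => x; rewrite /= in_itv.
Qed.

(** For every rational [q], approximate both [E `&` phi <= q] and its complement
    in [E] from inside by compact sets. On the intersection over [q] of the
    unions of these two compact sets, every sublevel set of [phi] at a rational
    level is relatively open and closed. *)
Lemma hausdorff_lusin (E : set 'rV[R]_n) (e : R) : (0 < e)%R ->
    (hausdorff d).-cara.-measurable E -> hausdorff d E < +oo ->
  exists L, [/\ compact L, L `<=` E, {within L, continuous phi} &
    hausdorff d (E `\` L) < e%:E].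
Proof.
move=> e0 mE Eoo.
have e20 : (0 < e / 2)%R by rewrite divr_gt0.
have e2e : (e / 2)%:E < e%:E.
  by rewrite lte_fin ltr_pdivrMr// ltr_pMr// ltr1n.
pose A (q : R) := E `&` [set x | (phi x <= q)%R].
pose B (q : R) := E `\` [set x | (phi x <= q)%R].
pose q k : R := ratr (odflt 0%Q (unpickle k)).
have H k : exists LL : set 'rV[R]_n * set 'rV[R]_n,
    [/\ compact LL.1, compact LL.2, LL.1 `<=` A (q k), LL.2 `<=` B (q k) &
      hausdorff d (E `\` (LL.1 `|` LL.2)) <= (e / 2 / (2 ^ k.+1)%:R)%:E].
  have ek : (0 < e / 2 / (2 ^ k.+1)%:R / 2)%R.
    by rewrite !divr_gt0// ltr0n expn_gt0.
  have mA : (hausdorff d).-cara.-measurable (A (q k)) by exact: measurableI.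
  have mB : (hausdorff d).-cara.-measurable (B (q k)) by exact: measurableD.
  have Aoo : hausdorff d (A (q k)) < +oo.
    by apply: le_lt_trans Eoo; apply: le_outer_measure => x [].
  have Boo : hausdorff d (B (q k)) < +oo.
    by apply: le_lt_trans Eoo; apply: le_outer_measure => x [].
  have [L1 [c1 L1A L1e]] := hausdorff_compact_approx d0 mA Aoo ek.
  have [L2 [c2 L2A L2e]] := hausdorff_compact_approx d0 mB Boo ek.
  exists (L1, L2); split => //=.
  apply: (@le_trans _ _ (hausdorff d ((A (q k) `\` L1) `|` (B (q k) `\` L2)))).
    apply: le_outer_measure => x [Ex /not_orP[x1 x2]].
    by have [xq|xq] := pselect (phi x <= q k)%R; [left|right].
  apply: le_trans (outer_measureU2 _ _ _) _.
  rewrite [X in _ <= X%:E]splitr EFinD; apply: leeD; exact: ltW.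
have [LL HL] := choice H.
have cl1 k : closed (LL k).1.
  by apply: compact_closed; [exact: norm_hausdorff|case: (HL k)].
have cl2 k : closed (LL k).2.
  by apply: compact_closed; [exact: norm_hausdorff|case: (HL k)].
pose L := \bigcap_k ((LL k).1 `|` (LL k).2).
exists L; split.
- apply: (@subclosed_compact _ _ ((LL 0%N).1 `|` (LL 0%N).2)).
  + by apply: closed_bigI => k _; exact: closedU.
  + by apply: compactU; case: (HL 0%N).
  + by move=> x /(_ 0%N I).
- by move=> x /(_ 0%N I); have [_ _ LA LB _] := HL 0%N; move=> [/LA[]|/LB[]].
- apply/subspace_continuousP => x Lx; apply/cvgrPdist_lt => r r0.
  have /rat_in_itvoo[q1 /itvP q1x] : (phi x - r < phi x)%R by rewrite ltrBlDr ltrDl.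
  have /rat_in_itvoo[q2 /itvP q2x] : (phi x < phi x + r)%R by rewrite ltrDl.
  have [q1r q1x'] : (phi x - r < ratr q1)%R /\ (ratr q1 < phi x)%R by rewrite !q1x.
  have [q2r q2x'] : (ratr q2 < phi x + r)%R /\ (phi x < ratr q2)%R by rewrite !q2x.
  pose k1 := pickle q1; pose k2 := pickle q2.
  have qk1 : q k1 = ratr q1 by rewrite /q pickleK.
  have qk2 : q k2 = ratr q2 by rewrite /q pickleK.
  have n1 : nbhs x (~` (LL k1).1).
    apply: open_nbhs_nbhs; split; first exact: closed_openC.
    have [_ _ LA _ _] := HL k1; move=> /LA[_ /=]; rewrite qk1 leNgt.
    by rewrite q1x'.
  have n2 : nbhs x (~` (LL k2).2).
    apply: open_nbhs_nbhs; split; first exact: closed_openC.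
    have [_ _ _ LB _] := HL k2; move=> /LB[_ /=]; rewrite qk2; apply.
    exact: ltW.
  apply: filterS (filterI n1 n2) => y [y1 y2] Ly.
  have yq1 : (ratr q1 < phi y)%R.
    have [/y1//|] := Ly k1 I.
    have [_ _ _ LB _] := HL k1; move=> /LB[_ /= /negP]; rewrite qk1.
    by rewrite -ltNge.
  have yq2 : (phi y <= ratr q2)%R.
    have [|/y2//] := Ly k2 I.
    by have [_ _ LA _ _] := HL k2; move=> /LA[_ /=]; rewrite qk2.
  have h1 := lt_trans q1r yq1; have h2 := le_lt_trans yq2 q2r.
  by rewrite /from_subspace/= ltr_norml; apply/andP; split; lra.
- apply: le_lt_trans e2e; apply: le_trans (epsilon_trick0 xpredT (ltW e20)).
  apply: (@le_trans _ _ (\sum_(k <oo) hausdorff d (E `\` ((LL k).1 `|` (LL k).2)))).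
    apply: le_trans (outer_measure_sigma_subadditive _ _).
    apply: le_outer_measure => x [Ex /existsNP[k /not_implyP[_ Lx]]].
    by exists k.
  apply: lee_nneseries => [k *|k _]; first exact: hausdorff_ge0.
  by have [_ _ _ _] := HL k.
Qed.

End lusin.

(** * The Lebesgue coordinate of a set *)

Section coordinate.
Context {R : realType} {n : nat} (d : R).
Hypothesis d0 : 0 < d.
Local Open Scope ereal_scope.
Let X := caratheodory_type (hausdorff (R := R) (n := n) d).
Context (phi : 'rV[R]_n -> R) (D : set 'rV[R]_n).
Hypothesis mphi : measurable_fun [set: X] (phi : X -> measurableTypeR R).
Hypothesis phi_ge0 : forall x, (0 <= phi x)%R.
Hypothesis mD : (hausdorff d).-cara.-measurable D.
Hypothesis phi_inj : forall x y, D x -> D y -> phi x = phi y -> x = y.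
Hypothesis phi_fin : forall t, hausdorff d (D `&` [set x | (phi x <= t)%R]) < +oo.

Let nu : {measure set (measurableTypeR R) -> \bar R} :=
  measure_function_pushforward__canonical__measure_function_Measure
    (mrestr (hausdorff_measure n d) mD) mphi.

Let nuE S : nu S = hausdorff d (phi @^-1` S `&` D).
Proof. by []. Qed.

Let nu_fin t : nu `]-oo, t]%classic < +oo.
Proof.
rewrite nuE setIC; apply: le_lt_trans (phi_fin t); apply: le_outer_measure.
by move=> x [Dx /=]; rewrite in_itv.
Qed.

Let nu_pt t : nu [set t] = 0.
Proof.
rewrite nuE; apply/eqP; rewrite eq_le outer_measure_ge0 andbT.
have [->|/set0P[x [xt Dx]]] := eqVneq (phi @^-1` [set t] `&` D) set0.
  by rewrite outer_measure0.
apply: (@le_trans _ _ (hausdorff d [set x])); last by rewrite hausdorff1.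
apply: le_outer_measure => y [yt Dy]; apply: phi_inj => //.
by rewrite xt yt.
Qed.

Let nu_neg : nu `]-oo, 0%R[%classic = 0.
Proof.
rewrite nuE (_ : _ `&` _ = set0) ?outer_measure0//.
apply/seteqP; split => // x [/=]; rewrite in_itv/= ltNge.
by rewrite phi_ge0.
Qed.

Let nuT : nu setT = hausdorff d D.
Proof. by rewrite nuE preimage_setT setTI. Qed.

(** Composing [phi] with the distribution function of its image measure turns
    that measure into Lebesgue measure. *)
Definition spread (x : 'rV[R]_n) : R := distr nu (phi x).
Local Notation g := spread.

Let mF : measurable_fun [set: measurableTypeR R]
  (distr nu : measurableTypeR R -> measurableTypeR R).
Proof. exact: continuous_measurable_fun (continuous_distr nu_fin nu_pt). Qed.

Lemma measurable_spread (S : set R) : measurable S ->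
  (hausdorff d).-cara.-measurable (D `&` g @^-1` S).
Proof.
move=> mS; apply: measurableI => //.
by have := mphi measurableT (mF measurableT mS); rewrite !setTI.
Qed.

Lemma hausdorff_spread (S : set R) : measurable S ->
  hausdorff d (D `&` g @^-1` S) =
  lebesgue_measure (S `&` below (hausdorff d D)).
Proof.
by move=> mS; rewrite -nuT -(distr_lebesgue nu_fin nu_pt nu_neg mS) setIC.
Qed.

(** If [spread] takes the same value at two different points of [D], their
    images under [phi] are separated by a rational [q], at which the
    distribution function has this value too. Removing countably many level
    sets, all null, therefore makes [spread] injective. *)
Definition spread_regular : set 'rV[R]_n :=
  D `\` \bigcup_(q : rat) g @^-1` [set distr nu (ratr q)].

Lemma spread_regular_sub : spread_regular `<=` D. Proof. by move=> x []. Qed.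

Lemma measurable_spread_regular :
  (hausdorff d).-cara.-measurable spread_regular.
Proof.
rewrite (_ : spread_regular =
    D `\` \bigcup_(q : rat) (D `&` g @^-1` [set distr nu (ratr q)])).
  apply: measurableD => //; apply: bigcupT_measurable_rat => q.
  by apply: measurable_spread; exact: measurable_set1.
apply/seteqP; split => x [Dx xq]; split => //; apply: contra_not xq.
  by move=> [q _ [_ xq]]; exists q.
by move=> [q _ xq]; exists q.
Qed.

Lemma spread_singular0 : hausdorff d (D `\` spread_regular) = 0.
Proof.
(* Countable subadditivity needs a union indexed by natural numbers. *)
have qE : \bigcup_(q : rat) (D `&` g @^-1` [set distr nu (ratr q)]) =
    \bigcup_k (D `&` (if unpickle k is Some q then
       g @^-1` [set distr nu (ratr q)] else set0)).
  apply/seteqP; split => [x [q _ [Dx xq]]|x [k _ [Dx]]].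
    by exists (pickle q); [exact: I|rewrite pickleK; split].
  by case: (unpickle k) => // q xq; exists q.
apply/eqP; rewrite eq_le outer_measure_ge0 andbT.
apply: (@le_trans _ _ (hausdorff d (\bigcup_(q : rat)
    (D `&` g @^-1` [set distr nu (ratr q)])))).
  apply: le_outer_measure => x [Dx /not_andP[//|/contrapT[q _ xq]]].
  by exists q.
rewrite qE; apply: le_trans (outer_measure_sigma_subadditive _ _) _.
rewrite eseries0// => k _ _; case: (unpickle k) => [q|]; last first.
  by rewrite setI0 outer_measure0.
apply: etrans (hausdorff_spread (measurable_set1 _)) _.
apply/eqP; rewrite eq_le measure_ge0 andbT.
apply: (@le_trans _ _ (lebesgue_measure [set distr nu (ratr q)])); last first.
  by rewrite lebesgue_measure_set1.
apply: le_measure; rewrite ?inE; last by move=> x [].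
  by apply: measurableI; [exact: measurable_set1|exact: below_measurable].
exact: measurable_set1.
Qed.

Lemma spread_inj x y : spread_regular x -> D y -> g x = g y -> x = y.
Proof.
move=> [Dx xq] Dy gxy; apply: phi_inj => //; apply: contrapT => /eqP.
rewrite neq_lt => /orP[] /rat_in_itvoo[q /itvP qxy]; apply: xq; exists q => //=.
  apply/eqP; rewrite eq_le distr_nd ?qxy//=.
  by rewrite gxy distr_nd ?qxy.
apply/eqP; rewrite eq_le gxy distr_nd ?qxy//=.
by rewrite -gxy distr_nd ?qxy.
Qed.

Lemma continuous_spread L : {within L, continuous phi} -> {within L, continuous g}.
Proof.
move=> /subspace_continuousP cphi; apply/subspace_continuousP => x Lx.
apply: (@cvg_comp _ _ _ phi (distr nu) _ (nbhs (phi x))); first exact: cphi.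
exact: continuous_distr.
Qed.

(** Lusin's theorem applies to the parts of [E] below the integer levels of
    [phi], which have finite measure. *)
Lemma spread_compact_cover (E : set 'rV[R]_n) :
    (hausdorff d).-cara.-measurable E -> E `<=` D ->
  exists L : (set 'rV[R]_n)^nat, [/\ forall k, compact (L k), forall k, L k `<=` E,
    forall k, {within L k, continuous g} & hausdorff d (E `\` \bigcup_k L k) = 0].
Proof.
move=> mE ED.
pose Ej (j : nat) := E `&` [set x | (phi x <= j%:R)%R].
have mEj j : (hausdorff d).-cara.-measurable (Ej j).
  apply: measurableI => //.
  rewrite (_ : [set x | (phi x <= j%:R)%R] = setT `&` phi @^-1` `]-oo, j%:R]%classic).
    exact: mphi.
  by rewrite setTI; apply/seteqP; split => x; rewrite /= in_itv.
have Ejoo j : hausdorff d (Ej j) < +oo.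
  apply: le_lt_trans (phi_fin j%:R); apply: le_outer_measure => x [Ex xj].
  by split => //; exact: ED.
have H (jm : nat * nat) : exists L, [/\ compact L, L `<=` Ej jm.1,
    {within L, continuous phi} & hausdorff d (Ej jm.1 `\` L) < (jm.2.+1%:R^-1)%:E].
  by apply: hausdorff_lusin => //; rewrite invr_gt0.
have [L HL] := choice H.
(* Pairs are enumerated by [pickle]; the default value only repeats a set. *)
pose jm k := odflt (0, 0)%N (unpickle k : option (nat * nat)).
exists (L \o jm); split.
- by move=> k; case: (HL (jm k)).
- by move=> k x /=; have [_ LE _ _] := HL (jm k); move=> /LE[].
- by move=> k; apply: continuous_spread; case: (HL (jm k)).
- apply/eqP; rewrite eq_le outer_measure_ge0 andbT.
  apply: (@le_trans _ _ (hausdorff d (\bigcup_j (Ej j `\` \bigcup_k (L \o jm) k)))).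
    apply: le_outer_measure => x [Ex xL]; exists (Num.truncn (phi x)).+1 => //.
    by split => //; split => //=; rewrite ltW// truncnS_gt.
  apply: le_trans (outer_measure_sigma_subadditive _ _) _.
  rewrite eseries0// => j _ _; apply/eqP; rewrite eq_le outer_measure_ge0 andbT.
  apply/lee_addgt0Pr => e e0; rewrite add0e.
  have [m _ /(_ m (leqnn _)) /= me] := near_infty_natSinv_lt (PosNum e0).
  apply: (@le_trans _ _ (hausdorff d (Ej j `\` L (j, m)))).
    apply: le_outer_measure => x [Ejx xL]; split => // Lx; apply: xL.
    by exists (pickle (j, m)); [exact: I|rewrite /comp /jm pickleK].
  have [_ _ _ /ltW/le_trans] := HL (j, m); apply.
  by rewrite lee_fin ltW.
Qed.

(** The image of a compact set on which [spread] is continuous is compact.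
    Exhausting [E] and its complement by such sets up to null sets yields Borel
    sets [A] and [B] inside the two images; the part of the range that they miss
    pulls back to a null set. *)
Lemma spread_image (E : set 'rV[R]_n) :
    (hausdorff d).-cara.-measurable E -> E `<=` D ->
  exists A B : set R, [/\ measurable A, measurable B,
    A `<=` g @` (E `&` spread_regular), B `<=` g @` (spread_regular `\` E) &
    lebesgue_measure (~` (A `|` B) `&` below (hausdorff d D)) = 0].
Proof.
move=> mE ED.
have mreg := measurable_spread_regular.
have [L [cL LE gL L0]] := spread_compact_cover (measurableI _ _ mE mreg)
  (fun x => @spread_regular_sub x \o snd).
have [L' [cL' LE' gL' L0']] := spread_compact_cover (measurableD mreg mE)
  (fun x => @spread_regular_sub x \o fst).
have mimg (K : (set 'rV[R]_n)^nat) : (forall k, compact (K k)) ->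
    (forall k, {within K k, continuous g}) -> measurable (\bigcup_k g @` K k).
  move=> cK gK; apply: bigcupT_measurable => k; apply: closed_measurable.
  apply: compact_closed; first exact: Rhausdorff.
  exact: continuous_compact.
exists (\bigcup_k g @` L k), (\bigcup_k g @` L' k); split.
- exact: mimg.
- exact: mimg.
- by move=> _ [k _ [x Lx <-]]; exists x => //; exact: LE Lx.
- by move=> _ [k _ [x Lx <-]]; exists x => //; exact: LE' Lx.
- have mAB : measurable (~` (\bigcup_k g @` L k `|` \bigcup_k g @` L' k)).
    by apply: measurableC; apply: measurableU; exact: mimg.
  rewrite -hausdorff_spread//; apply/eqP; rewrite eq_le outer_measure_ge0 andbT.
  apply: (@le_trans _ _ (hausdorff d ((D `\` spread_regular) `|`
     ((E `&` spread_regular) `\` \bigcup_k L k `|`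
      (spread_regular `\` E) `\` \bigcup_k L' k)))).
    apply: le_outer_measure => x [Dx /= /not_orP[xA xB]].
    have [rx|rx] := pselect (spread_regular x); last by left; split.
    right; have [Ex|Ex] := pselect (E x); [left|right]; split => //.
      by move=> [k _ Lx]; apply: xA; exists k => //; exists x.
    by move=> [k _ Lx]; apply: xB; exists k => //; exists x.
  apply: le_trans (outer_measureU2 _ _ _) _.
  rewrite [X in X + _](_ : _ = 0) ?add0e; last exact: spread_singular0.
  apply: le_trans (outer_measureU2 _ _ _) _.
  rewrite [X in X + _](_ : _ = 0) ?add0e; last exact: L0.
  by rewrite [X in X <= _](_ : _ = 0); last exact: L0'.
Qed.

End coordinate.

(** * Injective measurable real functions *)

Section separating_function.
Context {R : realType} {n : nat} (d : R).
Hypothesis d0 : 0 < d.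
Let X := caratheodory_type (hausdorff (R := R) (n := n) d).

Definition halfspace_code (x : 'rV[R]_n) (k : nat) : bool :=
  if (unpickle k : option ('I_n * rat)) is Some iq
  then x ord0 iq.1 <= ratr iq.2 else false.

(** Rational half-spaces separate points; their indicator functions are packed
    into one real number. *)
Definition separating (x : 'rV[R]_n) : R := bit_code (halfspace_code x).

Lemma separating_bounds x : 0 <= separating x <= 2.
Proof. exact: bit_code_bounds. Qed.

Lemma separating_inj : injective separating.
Proof.
move=> x y /bit_code_inj xyk.
have {xyk} xyq (i : 'I_n) (q : rat) : (x ord0 i <= ratr q) = (y ord0 i <= ratr q).
  have := congr1 (fun f => f (pickle (i, q))) xyk.
  by rewrite /halfspace_code pickleK.
apply/rowP => i; apply: contrapT => /eqP.
rewrite neq_lt => /orP[] /rat_in_itvoo[q /itvP qxy].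
  by have := xyq i q; rewrite [RHS]leNgt !qxy.
by have := xyq i q; rewrite [LHS]leNgt !qxy.
Qed.

Lemma measurable_separating :
  measurable_fun [set: X] (separating : X -> measurableTypeR R).
Proof.
apply: (@measurable_fun_cvg _ X R setT (fun m x =>
  series (fun k => 4^-1 ^+ k * (halfspace_code x k : nat)%:R) m)); last first.
  by move=> x _; exact: bit_code_cvg.
move=> m; apply: measurable_sum => k; apply: measurable_funM.
  exact: measurable_cst.
rewrite (_ : (fun x : X => _) = \1_([set x : X | halfspace_code x k])); last first.
  by apply/funext => x; rewrite indicE; congr (_%:R); congr nat_of_bool;
    apply/idP/idP; rewrite inE.
apply: measurable_indic; rewrite /halfspace_code; case: unpickle => [iq|].
  exact: (measurable_coord_le _ _ (ltW d0)).
by rewrite (_ : mkset _ = set0)//; apply/seteqP; split.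
Qed.

Section stacked.
Context (kappa : 'rV[R]_n -> nat).
Hypothesis mkappa : forall j,
  (hausdorff d).-cara.-measurable [set x : 'rV[R]_n | kappa x = j].

(** The factor [3] exceeds the upper bound [2] of [separating]: pieces with
    different [kappa] have disjoint ranges, and a bounded range involves
    finitely many pieces. *)
Definition stacked (x : 'rV[R]_n) : R := 3 * (kappa x)%:R + separating x.

Lemma measurable_stacked :
  measurable_fun [set: X] (stacked : X -> measurableTypeR R).
Proof.
apply: (@measurable_funD _ X R setT (fun x => 3 * (kappa x)%:R) separating).
  move=> _ S mS; rewrite setTI.
  rewrite (_ : _ @^-1` S = \bigcup_j (if `[< S (3 * j%:R) >]
      then [set x : X | kappa x = j] else set0)).
    by apply: bigcupT_measurable => j; case: ifPn => // _; exact: mkappa.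
  apply/seteqP; split => [x Sx|x [j _]].
    by exists (kappa x) => //; rewrite ifT//; exact/asboolP.
  by case: ifPn => // /asboolP Sj /= xj; rewrite xj.
exact: measurable_separating.
Qed.

Lemma stacked_ge0 x : 0 <= stacked x.
Proof.
by rewrite addr_ge0 ?mulr_ge0//; have /andP[] := separating_bounds x.
Qed.

Lemma stacked_inj : injective stacked.
Proof.
move=> x y; rewrite /stacked => xy; apply: separating_inj.
suff kxy : kappa x = kappa y by move: xy; rewrite kxy => /addrI.
have /andP[x0 x2] := separating_bounds x; have /andP[y0 y2] := separating_bounds y.
apply/eqP; rewrite eqn_leq; apply/andP; split; rewrite leqNgt; apply/negP;
  rewrite -(ler_nat R) -natr1 => H; lra.
Qed.

Lemma stacked_fin (D : set 'rV[R]_n) (t : R) :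
    (forall j, hausdorff d (D `&` [set x | kappa x = j]) < +oo)%E ->
  (hausdorff d (D `&` [set x | (stacked x <= t)%R]) < +oo)%E.
Proof.
move=> Dj; pose J := (Num.truncn t).+1.
apply: (@le_lt_trans _ _ (\sum_(j < J) hausdorff d (D `&` [set x | kappa x = j]))%E).
  apply: le_trans (outer_measure_subadditive (hausdorff d)
    (fun j => D `&` [set x | kappa x = j]) J).
  apply: le_outer_measure => x [Dx /= xt].
  rewrite -(bigcup_mkord J (fun j => D `&` [set x | kappa x = j])).
  exists (kappa x) => //=.
  rewrite -(ltr_nat R); apply: le_lt_trans (truncnS_gt t).
  have /andP[x0 x2] := separating_bounds x.
  by have := ler0n R (kappa x); move: xt; rewrite /stacked; lra.
by apply: lte_sum_pinfty => j _; exact: Dj.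
Qed.

End stacked.
End separating_function.

(** * Uncountable null sets *)

Lemma uncountable_bool_seq : ~ countable [set: nat -> bool].
Proof.
move=> /countable_injP[f finj].
pose s k := ~~ `[< exists t, f t = k /\ t k >].
have : s (f s) = ~~ s (f s).
  rewrite {1}/s; congr (~~ _); apply/asboolP/idP => [[t [ft tk]]|sk].
    have ts : t = s by apply: finj; rewrite ?inE.
    by rewrite -{1}ts.
  by exists s.
by case: (s (f s)).
Qed.

Lemma countable_image T U (A : set T) (f : T -> U) : countable A ->
  countable (f @` A).
Proof. by move=> cA; apply: sub_countable cA; exact: card_image_le. Qed.

Lemma uncountable_inj_image T (f : (nat -> bool) -> T) (A : set T) :
  injective f -> (forall s, A (f s)) -> ~ countable A.
Proof.
move=> fi fA /countable_injP[g ginj]; apply: uncountable_bool_seq.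
apply/countable_injP; exists (g \o f) => s t _ _ /ginj => gst.
by apply: fi; apply: gst; rewrite inE; exact: fA.
Qed.

Section cantor_null_set.
Context {R : realType} (m : R).
Hypothesis m0 : 0 < m.
Local Open Scope ereal_scope.

(** As [bit_code] takes values between [0] and [2], these points lie between
    [m / 4] and [3 * m / 4]. *)
Let pt (s : nat -> bool) : R := (m / 4 * (1 + bit_code s))%R.

Let mesh k (w : {ffun 'I_k -> bool}) : set R :=
  [set y | (`|y - pt (fun i => if insub i is Some i' then w i' else false)| <=
     m / 4 * (2%:R * 4^-1 ^+ k))%R].

Let mesh_itv k (w : {ffun 'I_k -> bool}) : exists a,
  mesh w = `[a, (a + m * 4^-1 ^+ k)%R]%classic.
Proof.
exists (pt (fun i => if insub i is Some i' then w i' else false) -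
   m / 4 * (2%:R * 4^-1 ^+ k))%R.
apply/seteqP; split => y; rewrite /mesh/= in_itv/= ler_distl => /andP[h1 h2];
  apply/andP; split; lra.
Qed.

(** The affine copies of the binary sequences under [bit_code]: at level [k]
    they are covered by [2 ^ k] intervals of total length [m / 2 ^ k]. *)
Lemma null_cantor_set : exists C : set R, [/\ measurable C,
  C `<=` `]0%R, m[, ~ countable C & lebesgue_measure C = 0].
Proof.
have m4 : (0 < m / 4)%R by rewrite divr_gt0.
pose C := `]0%R, m[ `&` \bigcap_k \bigcup_(w in [set: {ffun 'I_k -> bool}]) mesh w.
have mmesh k : measurable (\bigcup_(w in [set: {ffun 'I_k -> bool}]) mesh w).
  apply: fin_bigcup_measurable; first exact: finite_finset.
  by move=> w _; have [a ->] := mesh_itv w; exact: measurable_itv.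
have mC : measurable C by apply: measurableI => //; exact: bigcapT_measurable.
exists C; split => //.
- by move=> x [].
- apply: (@uncountable_inj_image _ pt).
    by move=> s t /(mulfI (lt0r_neq0 m4))/addrI/bit_code_inj.
  move=> s; split.
    rewrite /= in_itv/= /pt.
    have /andP[x0 x2] := @bit_code_bounds R s.
    set x := bit_code _ in x0 x2 *.
    rewrite mulr_gt0 ?ltr_wpDr//=; nra.
  move=> k _; exists [ffun i : 'I_k => s i] => //.
  rewrite /mesh/= /pt -mulrBr opprD addrACA subrr add0r normrM (gtr0_norm m4).
  rewrite ler_pM2l//; apply: bit_code_dist_le => i ik.
  by rewrite insubT ffunE.
- apply/eqP; rewrite eq_le measure_ge0 andbT.
  have half k : lebesgue_measure C <= (m * 2^-1 ^+ k)%:E.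
    pose N := #|{: {ffun 'I_k -> bool}}|.
    pose A i := if insub i is Some i' then mesh (enum_val (i' : 'I_N)) else set0.
    have AE (i : 'I_N) : A i = mesh (enum_val i) by rewrite /A valK.
    have mA i : measurable (A i).
      rewrite /A; case: insubP => // i' _ _.
      by have [a ->] := mesh_itv (enum_val i'); exact: measurable_itv.
    apply: (@le_trans _ _ (\sum_(i < N) lebesgue_measure (A i))).
      apply: content_subadditive => [i _||x [_ /(_ k I)[w _ xw]]] //.
        exact: mA.
      rewrite -bigcup_mkord; exists (enum_rank w); first exact: ltn_ord.
      by rewrite AE enum_rankK.
    rewrite (eq_bigr (fun=> (m * 4^-1 ^+ k)%:E)) => [|i _].
      rewrite sumEFin sumr_const card_ord lee_fin /N card_ffun card_bool card_ord.
      have -> (x : R) : (x *+ 2 ^ k = 2%:R ^+ k * x)%R by rewrite -natrX mulr_natl.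
      rewrite mulrCA ler_pM2l// -exprMn.
      by rewrite (_ : 2 * 4^-1 = 2^-1 :> R)%R//; lra.
    rewrite AE; have [a ->] := mesh_itv (enum_val i).
    rewrite lebesgue_measure_itv/= lte_fin.
    rewrite ltrDl mulr_gt0 ?exprn_gt0//.
    by rewrite -EFinB addrAC subrr add0r.
  apply/lee_addgt0Pr => e e0; rewrite add0e.
  have h1 : (`|2^-1| < 1 :> R)%R by rewrite ger0_norm// invf_lt1// ltr1n.
  have := cvg_expr h1 => /cvgrPdist_lt/(_ (e / m)%R).
  case; first by rewrite divr_gt0.
  move=> k _ /(_ k (leqnn _)); rewrite sub0r normrN ger0_norm ?exprn_ge0//.
  rewrite ltr_pdivlMr// mulrC => ke.
  by apply: le_trans (half k) _; rewrite lee_fin ltW.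
Qed.
End cantor_null_set.

Lemma open_lebesgue0 (R : realType) (U : set R) : open U ->
  lebesgue_measure U = 0%E -> U = set0.
Proof.
move=> oU U0; apply/seteqP; split => // x Ux.
have /nbhs_ballP[e /= e0 eU] : nbhs x U by exact: open_nbhs_nbhs.
have : (lebesgue_measure (ball x e) <= lebesgue_measure U)%E.
  apply: le_measure; rewrite ?inE//.
    by apply: measurable_ball.
  exact: open_measurable.
by rewrite U0 lebesgue_measure_ball ?(ltW e0)// lee_fin leNgt mulrn_wgt0.
Qed.

(** On a compact set [L] of positive measure where [separating] is continuous,
    [spread] has a compact image whose complement in [`]0, m[] is open and null,
    hence empty. The preimage of an uncountable Lebesgue null set is then null
    and uncountable. *)
Lemma hausdorff_uncountable_null (R : realType) (n : nat) (d : R)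
    (E : set 'rV[R]_n) : 0 < d -> (hausdorff d).-cara.-measurable E ->
    (0 < hausdorff d E < +oo)%E ->
  exists Z, [/\ Z `<=` E, hausdorff d Z = 0%E & ~ countable Z].
Proof.
move=> d0 mE /andP[E0 Eoo].
have Efin : hausdorff d E \is a fin_num by rewrite ge0_fin_numE ?hausdorff_ge0.
pose e := fine (hausdorff d E); have eE : hausdorff d E = e%:E by rewrite fineK.
have e0 : 0 < e by rewrite -lte_fin -eE.
have mpsi := @measurable_separating R n d d0.
have [L [cL LE psiL Le]] := hausdorff_lusin d0 mpsi e0 mE Eoo.
have mL := compact_measurable d0 cL.
have Loo : (hausdorff d L < +oo)%E.
  by apply: le_lt_trans Eoo; exact: le_hausdorff.
pose m := fine (hausdorff d L).
have mLE : hausdorff d L = m%:E by rewrite fineK// ge0_fin_numE ?hausdorff_ge0.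
have m0 : 0 < m.
  rewrite -lte_fin -mLE lt_neqAle hausdorff_ge0 andbT; apply/eqP => L0.
  have : (hausdorff d E <= hausdorff d L + hausdorff d (E `\` L))%E.
    apply: le_trans (outer_measureU2 (hausdorff d) _ _).
    by apply: le_outer_measure => x Ex; have [|] := pselect (L x); [left|right].
  by rewrite -L0 add0e leNgt eE Le.
have psi0 (x : 'rV[R]_n) : 0 <= separating x by have /andP[] := separating_bounds x.
have psi_inj (x y : 'rV[R]_n) : L x -> L y -> separating x = separating y -> x = y.
  by move=> _ _; exact: separating_inj.
have psi_fin t : (hausdorff d (L `&` [set x | (separating x <= t)%R]) < +oo)%E.
  by apply: le_lt_trans Loo; apply: le_outer_measure => x [].
pose g := spread mpsi mL.
have gL : {within L, continuous g} by exact: continuous_spread.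
have gS (S : set R) : measurable S ->
    hausdorff d (L `&` g @^-1` S) = lebesgue_measure (S `&` below (hausdorff d L)).
  exact: hausdorff_spread.
have cgL : closed (g @` L).
  by apply: compact_closed; [exact: Rhausdorff|exact: continuous_compact].
have below_itv : `]0, m[%classic `<=` below (hausdorff d L).
  move=> y; rewrite /= in_itv/= => /andP[y0 ym].
  by rewrite /below/= mLE lte_fin ltW.
have onto : `]0, m[%classic `<=` g @` L.
  have : ~` (g @` L) `&` `]0, m[%classic = set0.
    apply: open_lebesgue0.
      by apply: openI; [exact: closed_openC|exact: interval_open].
    apply/eqP; rewrite eq_le measure_ge0 andbT.
    have mgL : measurable (~` (g @` L)).
      by apply: measurableC; exact: closed_measurable.
    apply: (@le_trans _ _ (lebesgue_measure (~` (g @` L) `&` below (hausdorff d L)))).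
      apply: le_measure; rewrite ?inE.
      - exact: measurableI.
      - by apply: measurableI => //; exact: below_measurable.
      - by apply: setIS.
    rewrite -gS// (_ : _ `&` _ = set0) ?hausdorff0//.
    by apply/seteqP; split => // x [Lx]; apply; exists x.
  move=> V0 y ym; apply: contrapT => gy.
  have : (~` (g @` L) `&` `]0, m[%classic) y by split.
  by rewrite V0.
have [C [mC C0m Cunc C0]] := null_cantor_set m0.
exists (L `&` g @^-1` C); split.
- by move=> x [/LE].
- rewrite gS//; apply/eqP; rewrite eq_le measure_ge0 andbT -C0.
  apply: le_measure; rewrite ?inE; [|exact: mC|by move=> x []].
  by apply: measurableI => //; exact: below_measurable.
- move=> cZ; apply: Cunc; apply: sub_countable (countable_image g cZ).
  apply: subset_card_le => y Cy; have [x Lx gx] := onto _ (C0m _ Cy).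
  by exists x => //; split => //=; rewrite gx.
Qed.

(** * Isomorphism of two blocks *)

Lemma caratheodory_null (R : realType) (T : pointedType)
    (mu : {outer_measure set T -> \bar R}) (N : set T) :
  mu N = 0%E -> mu.-cara.-measurable N.
Proof.
move=> N0; apply: le_caratheodory_measurable => X.
apply: (@le_trans _ _ (mu N + mu X)%E); last by rewrite N0 add0e.
by apply: leeD; apply: le_outer_measure => x [].
Qed.

Lemma outer_measure_sub0 (R : realType) (T : Type)
    (mu : {outer_measure set T -> \bar R}) (N A : set T) :
  mu N = 0%E -> A `<=` N -> mu A = 0%E.
Proof.
move=> N0 AN; apply/eqP; rewrite eq_le outer_measure_ge0 andbT -N0.
exact: le_outer_measure.
Qed.

Lemma outer_measureU0 (R : realType) (T : Type)
    (mu : {outer_measure set T -> \bar R}) (A B : set T) :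
  mu A = 0%E -> mu B = 0%E -> mu (A `|` B) = 0%E.
Proof.
move=> A0 B0; apply/eqP; rewrite eq_le outer_measure_ge0 andbT.
by apply: le_trans (outer_measureU2 mu A B) _; rewrite A0 B0 adde0.
Qed.

Lemma caratheodory_eq_mod_null (R : realType) (T : pointedType)
    (mu : {outer_measure set T -> \bar R}) (W S N : set T) :
    mu.-cara.-measurable W -> mu N = 0%E -> (forall x, ~ N x -> S x <-> W x) ->
  mu.-cara.-measurable S /\ mu S = mu W.
Proof.
move=> mW N0 SW.
have SE : S = (W `\` N) `|` (S `&` N).
  apply/seteqP; split => [x Sx|x [[Wx Nx]|[]//]]; last exact/SW.
  by have [Nx|Nx] := pselect (N x); [right|left; split => //; exact/SW].
have SN0 : mu (S `&` N) = 0%E by apply: outer_measure_sub0 N0 _ => x [].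
split.
  rewrite SE; apply: measurableU; last exact: caratheodory_null.
  by apply: measurableD => //; exact: caratheodory_null.
apply/le_anti/andP; split.
  apply: (@le_trans _ _ (mu (W `|` N))).
    apply: le_outer_measure => x Sx.
    by have [Nx|Nx] := pselect (N x); [right|left; exact/SW].
  by apply: le_trans (outer_measureU2 mu W N) _; rewrite N0 adde0.
apply: (@le_trans _ _ (mu (S `|` N))).
  apply: le_outer_measure => x Wx.
  by have [Nx|Nx] := pselect (N x); [right|left; exact/SW].
by apply: le_trans (outer_measureU2 mu S N) _; rewrite N0 adde0.
Qed.

(** The trace of [mu] on [D] is modelled by Lebesgue measure on the half-line,
    up to the null set of the points of [D] outside [D1]. As images of
    measurable sets need not be Borel, [coordinate_image] squeezes the image of
    [E] between a Borel set [A] and the complement of a Borel set [B], up to a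
    Lebesgue null set. *)
Record lebesgue_coordinate (R : realType) (T : pointedType)
    (mu : {outer_measure set T -> \bar R}) (D D1 : set T) (g : T -> R) : Prop :=
  LebesgueCoordinate {
    coordinate_sub : D1 `<=` D;
    coordinate_null : mu (D `\` D1) = 0%E;
    coordinate_inj : forall x y, D1 x -> D1 y -> g x = g y -> x = y;
    coordinate_preimage : forall S : set R, measurable S ->
      mu.-cara.-measurable (D `&` g @^-1` S) /\
      mu (D `&` g @^-1` S) = lebesgue_measure (S `&` below +oo);
    coordinate_image : forall E : set T, mu.-cara.-measurable E -> E `<=` D ->
      exists A B : set R, [/\ measurable A, measurable B,
        A `<=` g @` (E `&` D1), B `<=` g @` (D1 `\` E) &
        lebesgue_measure (~` (A `|` B) `&` below +oo) = 0%E] }.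

Section matching.
Context {R : realType} {T T' : pointedType}.
Context (mu : {outer_measure set T -> \bar R}).
Context (mu' : {outer_measure set T' -> \bar R}).
Context (D D1 : set T) (g : T -> R) (D' D1' : set T') (g' : T' -> R).
Hypothesis crd : lebesgue_coordinate mu D D1 g.
Hypothesis crd' : lebesgue_coordinate mu' D' D1' g'.

Definition matched : set T := [set x | D1 x /\ exists2 y, D1' y & g' y = g x].

(** The correspondence [g x = g' y] is kept as a relation, so that the two
    spaces play symmetric roles. *)
Definition transfer (E : set T) : set T' :=
  [set y | D1' y /\ exists x, [/\ E x, D1 x & g x = g' y]].

Let measurable_D' : mu'.-cara.-measurable D'.
Proof. by have [] := coordinate_preimage crd' measurableT; rewrite setIT. Qed.

(** The values of [g'] on [D1'] contain almost all of the half-line. *)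
Lemma matched_null : mu (D `\` matched) = 0%E.
Proof.
have [A [B [mA mB AD1 BD1 AB0]]] := coordinate_image crd' measurable_D' (@subset_refl _ D').
have mAB : measurable (~` (A `|` B)) by apply: measurableC; exact: measurableU.
have [_ AB] := coordinate_preimage crd mAB.
apply: (outer_measure_sub0 (outer_measureU0 (coordinate_null crd) (etrans AB AB0))).
move=> x [Dx Cx]; have [D1x|D1x] := pselect (D1 x); [right|by left; split].
split => //= -[/AD1[y [_ D1y] gy]|/BD1[y [D1y]]].
  by apply: Cx; split => //; exists y.
by move=> + _; apply; exact: (coordinate_sub crd').
Qed.

(** Up to null sets, [E] and its transfer are the preimages of one and the same
    Borel set. *)
Lemma transfer_measurable (E : set T) : mu.-cara.-measurable E -> E `<=` D ->
  mu'.-cara.-measurable (transfer E) /\ mu' (transfer E) = mu E.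
Proof.
move=> mE ED; have [A [B [mA mB AE BE AB0]]] := coordinate_image crd mE ED.
have mAB : measurable (~` (A `|` B)) by apply: measurableC; exact: measurableU.
have [_ nAB] := coordinate_preimage crd mAB.
have [_ nAB'] := coordinate_preimage crd' mAB.
have [mA1 EA] := coordinate_preimage crd mA.
have [mA1' EA'] := coordinate_preimage crd' mA.
have N0 := outer_measureU0 (coordinate_null crd) (etrans nAB AB0).
have N0' := outer_measureU0 (coordinate_null crd') (etrans nAB' AB0).
have [_ EE] : mu.-cara.-measurable E /\ mu E = mu (D `&` g @^-1` A).
  apply: caratheodory_eq_mod_null mA1 N0 _ => x /not_orP[xD xAB].
  split => [Ex|[Dx /= gxA]].
    have Dx := ED _ Ex; split => //; apply: contrapT => gxA; apply: xAB.
    split => //= -[//|/BE[z [D1z nEz] gz]].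
    apply: xD; split => // D1x; apply: nEz.
    by rewrite (coordinate_inj crd D1z D1x gz).
  have [z [Ez D1z] gz] := AE _ gxA.
  suff D1x : D1 x by rewrite -(coordinate_inj crd D1z D1x gz).
  by apply: contrapT => D1x; apply: xD.
rewrite EE EA -EA'.
apply: caratheodory_eq_mod_null mA1' N0' _ => y /not_orP[yD yAB].
split => [[D1y [x [Ex D1x gxy]]]|[Dy /= gyA]].
  have Dy := coordinate_sub crd' D1y; split => //; apply: contrapT => gyA.
  apply: yAB; split => //= -[//|/BE[z [D1z nEz] gz]]; apply: nEz.
  by rewrite (coordinate_inj crd D1z D1x) // gz.
have [x [Ex D1x] gx] := AE _ gyA.
by split; [apply: contrapT => D1y; apply: yD|exists x].
Qed.

End matching.

Section block_isomorphism.
Context {R : realType} {T T' : pointedType}.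
Context (mu : {outer_measure set T -> \bar R}).
Context (mu' : {outer_measure set T' -> \bar R}).
Context (D D1 : set T) (g : T -> R) (D' D1' : set T') (g' : T' -> R).
Hypothesis CH : continuum_hypothesis R.
Hypothesis crd : lebesgue_coordinate mu D D1 g.
Hypothesis crd' : lebesgue_coordinate mu' D' D1' g'.
Context (i : T -> R) (i' : T' -> R) (Z : set T) (Z' : set T').
Hypotheses (i_inj : injective i) (i_inj' : injective i').
Hypotheses (ZD : Z `<=` D) (Z0 : mu Z = 0%E) (Zunc : ~ countable Z).
Hypotheses (ZD' : Z' `<=` D') (Z0' : mu' Z' = 0%E) (Zunc' : ~ countable Z').

Lemma uncountable_card_eq (N : set T) (N' : set T') :
  ~ countable N -> ~ countable N' -> (N #= N')%card.
Proof.
move=> cN cN'.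
have card_real (U : Type) (j : U -> R) (A : set U) : injective j ->
    ~ countable A -> (A #= [set: R])%card.
  move=> jinj cA; have jA : (j @` A #= A)%card.
    by apply: inj_card_eq => x y _ _; exact: jinj.
  have [cjA|] := CH (j @` A).
    by exfalso; apply: cA; rewrite -(eq_countable jA).
  by move=> jR; rewrite (card_eql jA) in jR.
apply: card_eq_trans (card_real _ _ _ i_inj cN) _.
by rewrite card_eq_sym; exact: card_real i_inj' cN'.
Qed.

(** On the matched part the map is determined: [F x] is the point [y] with
    [g' y = g x]. What is left on either side is null; enlarged by [Z], [Z'] and
    their counterparts it is also uncountable, so the continuum hypothesis
    provides a bijection of one remainder onto the other. Null sets and all
    their subsets are measurable, hence any bijection will do there. *)
Lemma block_isomorphism : exists f : T -> T', [/\ set_bij D D' f,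
  forall E, mu.-cara.-measurable E -> E `<=` D ->
    mu'.-cara.-measurable (f @` E) /\ mu' (f @` E) = mu E &
  forall E, mu'.-cara.-measurable E -> E `<=` D' ->
    mu.-cara.-measurable (D `&` f @^-1` E) /\ mu (D `&` f @^-1` E) = mu' E].
Proof.
pose C := matched D1 g D1' g'; pose C' := matched D1' g' D1 g.
have /choice[F HF] : forall x, exists y, C x -> C' y /\ g' y = g x.
  move=> x; have [[D1x [y D1y gy]]|Cx] := pselect (C x); last by exists point.
  by exists y => _; split => //; split => //; exists x.
have FC x : C x -> C' (F x) by move=> /HF[].
have gF x : C x -> g' (F x) = g x by move=> /HF[].
have FE x y : D1 x -> D1' y -> g x = g' y -> C x /\ F x = y.
  move=> D1x D1y gxy; have Cx : C x by split => //; exists y.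
  split => //; apply: (coordinate_inj crd') => //.
    by have [] := FC _ Cx.
  by rewrite gF.
have F_inj x y : C x -> C y -> F x = F y -> x = y.
  move=> Cx Cy Fxy; apply: (coordinate_inj crd); [exact: Cx.1|exact: Cy.1|].
  by rewrite -gF// Fxy gF.
(* [F] maps the complement of [N] in [D] onto the complement of [N'] in [D'];
   by construction [N] contains [Z], and [N'] contains [Z']. *)
pose N := (D `\` C) `|` (C `&` (Z `|` F @^-1` Z')).
pose N' := (D' `\` C') `|` (C' `&` Z') `|` F @` (C `&` Z).
have mZ := caratheodory_null Z0; have mZ' := caratheodory_null Z0'.
have N0 : mu N = 0%E.
  apply: outer_measureU0; first exact: (matched_null crd crd').
  have [_ tZ'] := transfer_measurable crd' crd mZ' ZD'.
  apply: outer_measure_sub0 (outer_measureU0 Z0 (etrans tZ' Z0')) _.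
  move=> x [Cx [Zx|Zx]]; [by left|right]; split; first exact: Cx.1.
  by exists (F x); split => //; [exact: (FC _ Cx).1|exact: gF].
have N0' : mu' N' = 0%E.
  have [_ tZ] := transfer_measurable crd crd' mZ ZD.
  apply: outer_measureU0.
    apply: outer_measureU0; first exact: (matched_null crd' crd).
    by apply: outer_measure_sub0 Z0' _ => y [].
  apply: outer_measure_sub0 (etrans tZ Z0) _ => _ [x [Cx Zx] <-].
  split; first exact: (FC _ Cx).1.
  by exists x; split => //; [exact: Cx.1|rewrite gF].
have NN' : (N #= N')%card.
  apply: uncountable_card_eq => cN.
    apply: Zunc; apply: sub_countable cN; apply: subset_card_le => x Zx.
    by have [Cx|Cx] := pselect (C x); [right; split => //; left|left; split => //; exact: ZD].
  apply: Zunc'; apply: sub_countable cN; apply: subset_card_le => y Zy; left.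
  by have [Cy|Cy] := pselect (C' y); [right|left; split => //; exact: ZD'].
have /pcard_eqP/unsquash h := NN'.
have hN x : N x -> N' (h x) by move=> Nx; exact: funS.
have h_inj x y : N x -> N y -> h x = h y -> x = y.
  by move=> Nx Ny; apply: inj; rewrite inE.
have h_surj y : N' y -> exists2 x, N x & h x = y by move=> /(@surj _ _ _ _ h).
have ND : N `<=` D.
  by move=> x [[]//|[[D1x _] _]]; exact: (coordinate_sub crd).
have ND' : N' `<=` D'.
  move=> y [[[]//|[[D1y _] _]]|[x [Cx _] <-]]; first exact: (coordinate_sub crd').
  by apply: (coordinate_sub crd'); exact: (FC _ Cx).1.
have DNC x : D x -> ~ N x -> C x.
  by move=> Dx Nx; apply: contrapT => Cx; apply: Nx; left.
have DNF x : D x -> ~ N x -> D' (F x) /\ ~ N' (F x).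
  move=> Dx Nx; have Cx := DNC _ Dx Nx; split.
    by apply: (coordinate_sub crd'); exact: (FC _ Cx).1.
  move=> [[[_]|[_ Zx]]|[z [Cz Zz] /(F_inj _ _ Cz Cx) zx]].
  - by apply; exact: FC.
  - by apply: Nx; right; split => //; right.
  - by apply: Nx; right; split => //; left; rewrite -zx.
have NF x : C x -> N x -> N' (F x).
  move=> Cx [[]//|[_ [Zx|Zx]]].
    by right; exists x.
  by left; right; split => //; exact: FC.
pose f x := if `[< N x >] then h x else F x.
have fN x : N x -> f x = h x by move=> Nx; rewrite /f asboolT.
have fF x : ~ N x -> f x = F x by move=> Nx; rewrite /f asboolF.
exists f; split.
- split.
  + move=> x Dx; have [Nx|Nx] := pselect (N x).
      by rewrite fN//; apply: ND'; exact: hN.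
    by rewrite fF//; exact: (DNF _ Dx Nx).1.
  + move=> x y; rewrite !inE => Dx Dy.
    have [Nx|Nx] := pselect (N x); have [Ny|Ny] := pselect (N y).
    * by rewrite !fN//; exact: h_inj.
    * rewrite fN// fF// => hF; exfalso; apply: (DNF _ Dy Ny).2.
      by rewrite -hF; exact: hN.
    * rewrite fF// fN// => hF; exfalso; apply: (DNF _ Dx Nx).2.
      by rewrite hF; exact: hN.
    * by rewrite !fF//; apply: F_inj; exact: DNC.
  + move=> y Dy; have [Ny|Ny] := pselect (N' y).
      have [x Nx hx] := h_surj _ Ny.
      by exists x; [exact: ND|rewrite fN].
    have Cy : C' y.
      by apply: contrapT => Cy; apply: Ny; left; left.
    have [D1y [x D1x gx]] := Cy.
    have [Cx Fx] := FE _ _ D1x D1y gx.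
    have Nx : ~ N x by move=> Nx; apply: Ny; rewrite -Fx; exact: NF.
    by exists x; [exact: (coordinate_sub crd)|rewrite fF].
- move=> E mE ED; have [mtE <-] := transfer_measurable crd crd' mE ED.
  apply: caratheodory_eq_mod_null mtE N0' _ => y Ny; split.
    move=> [x Ex xy]; have Nx : ~ N x.
      by move=> Nx; apply: Ny; rewrite -xy fN//; exact: hN.
    have Cx := DNC _ (ED _ Ex) Nx; rewrite -xy fF//.
    split; first exact: (FC _ Cx).1.
    by exists x; split => //; [exact: Cx.1|rewrite gF].
  move=> [D1y [x [Ex D1x gx]]]; have [Cx Fx] := FE _ _ D1x D1y gx.
  have Nx : ~ N x by move=> Nx; apply: Ny; rewrite -Fx; exact: NF.
  by exists x => //; rewrite fF.
- move=> E mE ED; have [mtE <-] := transfer_measurable crd' crd mE ED.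
  apply: caratheodory_eq_mod_null mtE N0 _ => x Nx; split.
    move=> [Dx /=]; rewrite fF// => Ex; have Cx := DNC _ Dx Nx.
    split; first exact: Cx.1.
    by exists (F x); split => //; [exact: (FC _ Cx).1|exact: gF].
  move=> [D1x [y [Ey D1y gy]]]; have [Cx Fx] := FE _ _ D1x D1y (esym gy).
  by split; [exact: (coordinate_sub crd)|rewrite /= fF// Fx].
Qed.

End block_isomorphism.

Lemma hausdorff_block_coordinate (R : realType) (n : nat) (d : R)
    (D : set 'rV[R]_n) (kappa : 'rV[R]_n -> nat) : 0 < d ->
    (hausdorff d).-cara.-measurable D ->
    (forall j, (hausdorff d).-cara.-measurable [set x : 'rV[R]_n | kappa x = j]) ->
    (forall j, hausdorff d (D `&` [set x | kappa x = j]) < +oo)%E ->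
    hausdorff d D = +oo%E ->
  exists D1 g, lebesgue_coordinate (hausdorff d) D D1 g.
Proof.
move=> d0 mD mkappa Dj Doo.
have mphi := measurable_stacked d0 mkappa.
have phi_inj (x y : 'rV[R]_n) : D x -> D y ->
    stacked kappa x = stacked kappa y -> x = y.
  by move=> _ _; exact: stacked_inj.
have phi_fin t := @stacked_fin R n d kappa D t Dj.
have phi0 := @stacked_ge0 R n kappa.
exists (spread_regular mphi mD), (spread mphi mD); split.
- exact: spread_regular_sub.
- exact: spread_singular0.
- move=> x y x1 y1; apply: (spread_inj phi_inj phi_fin x1).
  exact: spread_regular_sub y1.
- move=> S mS; split; first exact: measurable_spread.
  by rewrite -Doo; exact: hausdorff_spread.
- by move=> E mE ED; rewrite -Doo; exact: spread_image.
Qed.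

(** * Disjoint families and the continuum hypothesis *)

Lemma countable_bigcup_measurable d (T : measurableType d) (I : Type)
    (S : set I) (F : I -> set T) : countable S ->
  (forall t, S t -> measurable (F t)) -> measurable (\bigcup_(t in S) F t).
Proof.
rewrite -(eq_countable (card_setT _)) => cS mF; rewrite bigcup_set_type.
by apply: countable_bigcupT_measurable => // t; apply: mF; exact: set_valP.
Qed.

Lemma countable_bigcup_null (R : realType) (T I : Type)
    (mu : {outer_measure set T -> \bar R}) (S : set I) (F : I -> set T) :
    countable S -> (forall t, S t -> mu (F t) = 0%E) ->
  mu (\bigcup_(t in S) F t) = 0%E.
Proof.
move=> /countable_injP[f finj] F0.
apply/eqP; rewrite eq_le outer_measure_ge0 andbT.
apply: (@le_trans _ _ (mu (\bigcup_k \bigcup_(t in [set t | S t /\ f t = k]) F t))).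
  by apply: le_outer_measure => x [t St Ft]; exists (f t) => //; exists t.
apply: le_trans (outer_measure_sigma_subadditive _ _) _.
rewrite eseries0// => k _ _.
have [H|none] := pselect (exists t, S t /\ f t = k).
  have [t [St ft]] := H.
  apply: outer_measure_sub0 (F0 _ St) _ => x [s [Ss fs] Fs].
  by rewrite -(_ : s = t)//; apply: finj; rewrite ?inE// fs ft.
rewrite (_ : \bigcup_(_ in _) _ = set0) ?outer_measure0//.
by apply/seteqP; split => // x [t St _]; apply: none; exists t.
Qed.

Section disjoint_family.
Context {R : realType} {T I : pointedType}.
Context (mu : {outer_measure set T -> \bar R}) (F : I -> set T) (U : set T).
Local Open Scope ereal_scope.
Hypothesis mF : forall s, mu.-cara.-measurable (F s).
Hypothesis F_disj : forall s t x, F s x -> F t x -> s = t.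
Hypothesis Uoo : mu U < +oo.

Lemma finite_large (e : R) : (0 < e)%R ->
  finite_set [set s | e%:E < mu (F s `&` U)].
Proof.
move=> e0; apply: contrapT => /infiniteP/ppcard_leP[f].
have Fe k : e%:E < mu (F (f k) `&` U).
  have : [set s | e%:E < mu (F s `&` U)] (f k) by exact: funS.
  by [].
have f_inj j k : f j = f k -> j = k.
  by move=> fjk; apply: (@inj _ _ _ f); rewrite ?inE.
have tG : trivIset setT (F \o f).
  apply/trivIsetP => j k _ _ jk; apply/seteqP; split => // x [Fj Fk].
  by move/eqP: jk; apply; apply: f_inj; exact: F_disj Fj Fk.
have sumG N : (N%:R * e)%:E <= mu U.
  apply: (@le_trans _ _ (mu (U `&` \big[setU/set0]_(k < N) (F \o f) k))); last first.
    by apply: le_outer_measure => x [].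
  rewrite (caratheodory_additive (fun k => mF (f k)) tG).
  rewrite (_ : _%:E = \sum_(k < N) e%:E).
    by apply: lee_sum => k _; rewrite setIC; exact: ltW.
  by rewrite sumEFin sumr_const card_ord mulr_natl.
have Ufin : mu U \is a fin_num by rewrite ge0_fin_numE ?outer_measure_ge0.
have := sumG (Num.truncn (fine (mu U) / e)).+1.
rewrite -[X in _ <= X]fineK// lee_fin -ler_pdivlMr// leNgt.
by rewrite truncnS_gt.
Qed.

Lemma countable_positive : countable [set s | 0 < mu (F s `&` U)].
Proof.
rewrite (_ : [set s | _] = \bigcup_k [set s | (k.+1%:R^-1)%:E < mu (F s `&` U)]).
  apply: bigcup_countable => // k _; apply: finite_set_countable.
  by apply: finite_large; rewrite invr_gt0.
apply/seteqP; split => [s /= s0|s [k _] /=]; last first.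
  by apply: le_lt_trans; rewrite lee_fin invr_ge0.
have sfin : mu (F s `&` U) \is a fin_num.
  rewrite ge0_fin_numE ?outer_measure_ge0//; apply: le_lt_trans Uoo.
  by apply: le_outer_measure => x [].
move: s0; rewrite -(fineK sfin) lte_fin => s0.
have [k _ /(_ k (leqnn _)) /= ke] := near_infty_natSinv_lt (PosNum s0).
by exists k => //=; rewrite -(fineK sfin) lte_fin.
Qed.

End disjoint_family.

Section omega1.
Context {R : realType}.
Hypothesis CH : continuum_hypothesis R.

Lemma CH_injection (A : set R) : ~ countable A ->
  exists b : R -> R, (forall y, A (b y)) /\ injective b.
Proof.
move=> cA; have [//|/card_esym/pcard_eqP/unsquash b] := CH A.
exists b; split; first by move=> y; exact: funS.
by move=> x y; apply: (@inj _ _ _ b); rewrite inE.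
Qed.

(** A well-order of type omega_1. If a given well-order of the reals has an
    uncountable initial segment, the shortest such segment is equinumerous with
    the reals by the continuum hypothesis, and its order can be carried over. *)
Lemma CH_well_order : exists le : R -> R -> Prop, [/\
  (forall x y, le x y -> le y x -> x = y),
  (forall S : set R, S !=set0 -> exists2 m, S m & forall x, S x -> le m x) &
  (forall x, countable [set y | le y x])].
Proof.
have [W Wwo] := wochoice.well_ordering_principle R.
have Wmin (S : set R) : S !=set0 -> exists2 m, S m & forall x, S x -> W m x.
  move=> [x Sx]; have [|m [[Sm lb] _]] := Wwo [pred y | `[< S y >]].
    by exists x; apply/asboolP.
  exists m; first by move: Sm => /asboolP.
  by move=> y Sy; apply: lb; apply/asboolP.
have Wanti x y : W x y -> W y x -> x = y.
  move=> xy yx; have [|m [_ um]] := Wwo (pred2 x y).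
    by exists x; rewrite !inE eqxx.
  have Wrefl z : W z z.
    by have [w -> /(_ z erefl)] := Wmin [set z] (ex_intro _ z erefl).
  transitivity m; [symmetry|]; apply: um; split; rewrite ?inE ?eqxx ?orbT//;
    by move=> z; rewrite !inE => /orP[]/eqP ->.
have [none|] := pselect (forall x, countable [set y | W y x]).
  by exists W.
move=> /existsNP; set S := (X in exists x, X x) => S0.
have [x0 Sx0 x0min] := Wmin (fun x => ~ countable [set y | W y x]) S0.
have [|b [bA b_inj]] := @CH_injection [set y | W y x0 /\ y <> x0].
  move=> cA; apply: Sx0; apply: (@sub_countable _ _ _
    ([set y | W y x0 /\ y <> x0] `|` [set x0])).
    apply: subset_card_le => y /= yx0.
    by have [->|yx] := pselect (y = x0); [right|left].
  rewrite -bigcup2E; apply: bigcup_countable => // -[|[|k]] _ //=.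
exists (fun x y => W (b x) (b y)); split.
- by move=> x y xy yx; apply: b_inj; exact: Wanti.
- move=> A [x Ax]; have [|_ [m Am <-] mmin] := Wmin (b @` A); first by exists (b x), x.
  by exists m => // y Ay; apply: mmin; exists y.
- move=> x; have [bx0 bx] := bA x.
  have /countable_injP[f finj] : countable [set y | W y (b x)].
    apply: contrapT => /x0min x0b; apply: bx; exact: Wanti.
  apply/countable_injP; exists (f \o b) => y z; rewrite !inE/= => yx zx fyz.
  by apply: b_inj; apply: finj; rewrite ?inE.
Qed.

End omega1.

(** * Partition of the space into blocks *)

Lemma hull_code_inj (R : realType) (n : nat) :
  exists j : hull_code (n := n) -> R, injective j.
Proof.
pose J := (nat * nat * ('rV[rat]_n * 'rV[rat]_n))%type.
pose bits (s : hull_code (n := n)) (k : nat) : bool :=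
  if (unpickle k : option J) is Some x then `[< s x >] else false.
exists (fun s => bit_code (bits s)) => s t /bit_code_inj st.
apply/funext => x; apply/propext.
have := congr1 (fun f => f (pickle (x : J))) st.
rewrite /bits pickleK.
by case: (asboolP (s x)) => sx; case: (asboolP (t x)) => tx.
Qed.

Section partition.
Context {R : realType} {n : nat} (d : R).
Hypothesis CH : continuum_hypothesis R.
Hypotheses (n0 : (0 < n)%N) (d0 : 0 < d) (dn : d < n%:R).
Local Open Scope ereal_scope.
Local Notation X := 'rV[R]_n.

(** Index the hulls of finite measure by the reals in a well-order with
    countable initial segments, and send a point to the least index of a hull
    that contains it. A set of finite measure is contained in one hull, so only
    an initial segment of indices occurs on it. *)
Lemma hausdorff_partition : exists pi : X -> R, [/\
  (forall t, (hausdorff d).-cara.-measurable [set x : X | pi x = t]),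
  (forall t, hausdorff d [set x : X | pi x = t] < +oo) &
  (forall A, hausdorff d A < +oo -> countable (pi @` A))].
Proof.
have [le [le_anti le_min le_count]] := CH_well_order CH.
have [j j_inj] := hull_code_inj R n.
have [c cK] : exists c : R -> hull_code (n := n), forall s, c (j s) = s.
  exists (fun r => get [set s | j s = r]) => s.
  by apply: j_inj; apply: (getPex (P := [set t | j t = j s])); exists s.
pose V t : set X := if `[< hausdorff d (coded_hull (c t) : set X) < +oo >]
  then coded_hull (c t) else set0.
have mV t : (hausdorff d).-cara.-measurable (V t).
  by rewrite /V; case: ifPn => // _; apply: measurable_coded_hull; exact: ltW.
have Voo t : hausdorff d (V t) < +oo.
  by rewrite /V; case: asboolP => // _; rewrite hausdorff0.
have V_cover A : hausdorff d A < +oo -> exists t, A `<=` V t.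
  move=> Aoo; have [s [As sA]] := hausdorff_hull d0 Aoo.
  by exists (j s); rewrite /V cK asboolT// (le_lt_trans sA).
have piP x : exists t, V t x /\ forall s, V s x -> le t s.
  have [|t Vt tmin] := le_min [set t | V t x]; last by exists t.
  have [|t xt] := V_cover [set x]; first by rewrite hausdorff1.
  by exists t; exact: xt.
have [pi piE] := choice piP.
have fiberE t : [set x | pi x = t] =
    V t `\` \bigcup_(s in [set s | le s t /\ s <> t]) V s.
  apply/seteqP; split => [x <-|x [Vt xt]].
    have [Vx xmin] := piE x; split => // -[s [sx nsx] Vs].
    by apply: nsx; apply: le_anti => //; exact: xmin.
  have [Vx xmin] := piE x; apply: contrapT => pit; apply: xt.
  by exists (pi x) => //; split => //; exact: xmin.
exists pi; split.
- move=> t; rewrite fiberE; apply: measurableD => //.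
  apply: countable_bigcup_measurable => //.
  apply: sub_countable (le_count t); apply: subset_card_le.
  by move=> s [].
- move=> t; apply: le_lt_trans (Voo t); apply: le_outer_measure.
  by rewrite fiberE => x [].
- move=> A Aoo; have [t At] := V_cover A Aoo.
  apply: sub_countable (le_count t); apply: subset_card_le.
  by move=> _ [x Ax <-]; apply: (piE x).2; exact: At.
Qed.

(** Suppose that only countably many fibers have positive measure. Each of them
    meets all but countably many of the disjoint Cantor sets in a null set, so
    some Cantor set meets every fiber in a null set. As it meets only countably
    many fibers, it is null: a contradiction. *)
Lemma uncountably_many_positive_fibers (pi : X -> R) :
    (forall t, (hausdorff d).-cara.-measurable [set x : X | pi x = t]) ->
    (forall t, hausdorff d [set x : X | pi x = t] < +oo) ->
    (forall A, hausdorff d A < +oo -> countable (pi @` A)) ->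
  ~ countable [set t | 0 < hausdorff d [set x | pi x = t]].
Proof.
move=> mpi pioo picount cpos.
have [K [cK K_disj Kpos]] := hausdorff_disjoint_family n0 d0 dn.
have mK s : (hausdorff d).-cara.-measurable (K s).
  by apply: hausdorff_closed_measurable => //; exact: ltW.
apply: uncountable_bool_seq.
apply: sub_countable (bigcup_countable cpos (fun t _ =>
  @countable_positive _ _ (nat -> bool) (hausdorff d) K _ mK K_disj (pioo t))).
apply: subset_card_le => s _; apply: contrapT => sK.
have /andP[Ks0 Ksoo] := Kpos s.
suff Ks : hausdorff d (K s) = 0 by move: Ks0; rewrite Ks ltxx.
have KE : K s = \bigcup_(t in pi @` K s) (K s `&` [set x | pi x = t]).
  apply/seteqP; split => [x Kx|x [t _ []]//].
  by exists (pi x); [exists x|split].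
rewrite KE; apply: countable_bigcup_null; first exact: picount.
move=> t _; apply/eqP; rewrite eq_le hausdorff_ge0 andbT leNgt; apply/negP => Kt.
apply: sK; exists t => //=; apply: lt_le_trans Kt _.
by apply: le_outer_measure => x [].
Qed.

End partition.

(** The numbers [c r + m%:R], with [m] natural and [c r] strictly between [0]
    and [1], determine [r] and [m]; mapping them into [Q] gives disjoint
    infinite countable subsets of [Q] indexed by the reals [r]. The elements of
    the subset of index [r] are sent to [r], all other reals to themselves. *)
Lemma CH_regrouping (R : realType) (Q : set R) : continuum_hypothesis R ->
    ~ countable Q ->
  exists rho : R -> R, forall r, countable [set t | rho t = r] /\
    infinite_set [set t | Q t /\ rho t = r].
Proof.
move=> CH Qunc; have [b [bQ b_inj]] := CH_injection CH Qunc.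
have [C [_ C01 Cunc _]] := null_cantor_set (@ltr01 R).
have [c [cC c_inj]] := CH_injection CH Cunc.
pose e r (m : nat) := b (c r + m%:R).
have e_inj r m r' m' : e r m = e r' m' -> r = r' /\ m = m'.
  move=> /b_inj cc.
  have := C01 _ (cC r); rewrite /= in_itv/= => /andP[c0 c1].
  have := C01 _ (cC r'); rewrite /= in_itv/= => /andP[c0' c1'].
  have mm : m = m'.
    apply/eqP; rewrite eqn_leq; apply/andP; split; rewrite leqNgt; apply/negP;
      rewrite -(ler_nat R) -natr1 => H; lra.
  by split => //; apply: c_inj; move: cc; rewrite mm => /addIr.
have rhoP t : exists r, (forall r' m, e r' m = t -> r = r') /\
    ((forall r' m, e r' m <> t) -> r = t).
  have [[r [m erm]]|none] := pselect (exists r, exists m, e r m = t).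
    exists r; split; last by move=> /(_ r m).
    by move=> r' m' er'm'; apply: (e_inj _ m _ m' _).1; rewrite erm er'm'.
  exists t; split => // r' m erm; exfalso; apply: none.
  by exists r', m.
have [rho HR] := choice rhoP.
have rhoe r m : rho (e r m) = r by apply: (HR _).1 erefl.
exists rho => r; split.
  apply: (@sub_countable _ _ _ (range (e r) `|` [set r])).
    apply: subset_card_le => t /= rt.
    have [[r' [m erm]]|none] := pselect (exists r', exists m, e r' m = t).
      left; exists m => //; rewrite -erm; congr (e _ m).
      by rewrite -rt; apply: (HR t).1 erm.
    right; rewrite -rt; apply/esym/(HR t).2 => r' m erm; apply: none.
    by exists r', m.
  rewrite -bigcup2E; apply: bigcup_countable => // -[|[|k]] _ //=.
  exact: countable_image.
apply: (@sub_infinite_set _ (range (e r))).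
  by move=> _ [m _ <-]; split; [exact: bQ|exact: rhoe].
have -> : finite_set (range (e r)) = finite_set [set: nat].
  by apply: eq_finite_set; apply: inj_card_eq => m m' _ _ /e_inj[].
exact: infinite_nat.
Qed.

Section blocks.
Context {R : realType} {n : nat} (d : R).
Hypothesis CH : continuum_hypothesis R.
Hypotheses (n0 : (0 < n)%N) (d0 : 0 < d) (dn : d < n%:R).
Local Open Scope ereal_scope.
Local Notation X := 'rV[R]_n.

(** The fibers of the partition are put together in countable groups, each of
    which contains infinitely many fibers of measure greater than a fixed bound
    and therefore has infinite measure. *)
Lemma hausdorff_blocks : exists pi : X -> R, [/\
  (forall t, (hausdorff d).-cara.-measurable [set x : X | pi x = t]),
  (forall A, hausdorff d A < +oo -> countable (pi @` A)) &
  (forall t, exists D1 g Z, [/\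
     lebesgue_coordinate (hausdorff d) [set x | pi x = t] D1 g,
     Z `<=` [set x | pi x = t], hausdorff d Z = 0 & ~ countable Z])].
Proof.
have [pi [mpi pioo picount]] := @hausdorff_partition R n d CH d0.
have pos_unc := uncountably_many_positive_fibers n0 d0 dn mpi pioo picount.
pose Q k := [set t | (k.+1%:R^-1)%:E < hausdorff d [set x | pi x = t]].
have [k Qk] : exists k, ~ countable (Q k).
  apply: contrapT => /forallNP Qc; apply: pos_unc.
  apply: (@sub_countable _ _ _ (\bigcup_k Q k)); last first.
    by apply: bigcup_countable => // k _; exact: contrapT.
  apply: subset_card_le => t /= t0.
  have tfin : hausdorff d [set x | pi x = t] \is a fin_num.
    by rewrite ge0_fin_numE ?hausdorff_ge0.
  move: t0; rewrite -(fineK tfin) lte_fin => t0.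
  have [k _ /(_ k (leqnn _)) /= ke] := near_infty_natSinv_lt (PosNum t0).
  by exists k => //=; rewrite /Q/= -(fineK tfin) lte_fin.
have [rho Hrho] := CH_regrouping CH Qk.
pose D r := [set x | rho (pi x) = r].
have DE r : D r = \bigcup_(t in [set t | rho t = r]) [set x | pi x = t].
  by apply/seteqP; split => [x rx|x [t tr xt]]; [exists (pi x)|rewrite /D/= xt].
have mD r : (hausdorff d).-cara.-measurable (D r).
  by rewrite DE; apply: countable_bigcup_measurable => //; exact: (Hrho r).1.
exists (rho \o pi); split => [t|A Aoo|r]; first exact: mD.
  by rewrite -image_comp; apply: countable_image; exact: picount.
(* Infinitely many disjoint sets of measure greater than a constant do not
   fit into a set of finite measure. *)
have Doo : hausdorff d (D r) = +oo.
  apply: contrapT => /eqP Doo; apply: (Hrho r).2.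
  have fin := @finite_large _ _ R (hausdorff d) (fun t => [set x | pi x = t]) (D r) mpi.
  apply: sub_finite_set (fin _ _ (k.+1%:R^-1)%R _).
  - move=> t [Qt rt] /=; apply: lt_le_trans Qt _.
    by apply: le_outer_measure => x /= xt; split => //; rewrite /D/= xt.
  - by move=> s t x /= <- <-.
  - by rewrite ltey.
  - by rewrite invr_gt0.
have /countable_injP[f finj] := (Hrho r).1.
(* [kappa] numbers the countably many fibers that make up the block; its value
   outside the block is arbitrary. *)
pose kappa x := if `[< D r x >] then f (pi x) else 0%N.
have kE j : D r `&` [set x | kappa x = j] =
    \bigcup_(t in [set t | rho t = r /\ f t = j]) [set x | pi x = t].
  apply/seteqP; split => [x [Dx /=]|x [t [rt ft] xt]].
    by rewrite /kappa asboolT// => fj; exists (pi x).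
  have Dx : D r x by rewrite /D/= xt.
  by split => //=; rewrite /kappa asboolT// xt.
have kE1 j : exists2 t, True & D r `&` [set x | kappa x = j] `<=` [set x | pi x = t].
  have [[t [rt ft]]|none] := pselect (exists t, rho t = r /\ f t = j).
    exists t => //; rewrite kE => x [s [rs fs] /= ->].
    by apply: finj; rewrite ?inE// fs ft.
  exists 0%R => //; rewrite kE => x [s [rs fs] _]; exfalso; apply: none.
  by exists s.
have mDk j : (hausdorff d).-cara.-measurable (D r `&` [set x | kappa x = j]).
  rewrite kE; apply: countable_bigcup_measurable => //.
  apply: sub_countable (Hrho r).1; apply: subset_card_le.
  by move=> t [].
have Dkoo j : hausdorff d (D r `&` [set x | kappa x = j]) < +oo.
  have [t _ kt] := kE1 j; apply: le_lt_trans (pioo t).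
  exact: le_outer_measure.
have mk j : (hausdorff d).-cara.-measurable [set x | kappa x = j].
  rewrite (_ : [set x | kappa x = j] = (D r `&` [set x | kappa x = j]) `|`
      (if j == 0%N then ~` D r else set0)).
    apply: measurableU => //; case: ifPn => // _; exact: measurableC.
  apply/seteqP; split => x /=.
    have [Dx|Dx] := pselect (D r x); first by move=> xj; left.
    by rewrite {1}/kappa asboolF// => <-; right.
  case=> [[]//|]; case: eqP => [-> Dx|//].
  by rewrite /kappa asboolF.
have [D1 [g crd]] := hausdorff_block_coordinate d0 (mD r) mk Dkoo Doo.
exists D1, g.
have [j Dj] : exists j, 0 < hausdorff d (D r `&` [set x | kappa x = j]).
  apply: contrapT => /forallNP Dj0.
  suff : hausdorff d (D r) = 0 by rewrite Doo.
  rewrite (_ : D r = \bigcup_(j in [set: nat]) (D r `&` [set x | kappa x = j])).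
    apply: countable_bigcup_null => // j _.
    apply/eqP; rewrite eq_le hausdorff_ge0 andbT leNgt; apply/negP; exact: Dj0.
  by apply/seteqP; split => [x Dx|x [j _ []]//]; exists (kappa x).
have [|Z [ZD Z0 Zunc]] := hausdorff_uncountable_null d0 (mDk j).
  by rewrite Dj Dkoo.
by exists Z; split => // x /ZD[].
Qed.

End blocks.

(** * Gluing the isomorphisms of the blocks *)

Section fiber_gluing.
Context {R : realType} {T : pointedType} {I : Type}.
Context (mu : {outer_measure set T -> \bar R}) (pi : T -> I).
Local Open Scope ereal_scope.
Hypothesis mpi : forall t, mu.-cara.-measurable [set x | pi x = t].
Hypothesis picount : forall A, mu A < +oo -> countable (pi @` A).

(** It suffices to test measurability on sets [A] of finite measure, and these
    meet only countably many fibers. *)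
Lemma fiberwise_measurable (E : set T) :
    (forall t, mu.-cara.-measurable (E `&` [set x | pi x = t])) ->
  mu.-cara.-measurable E.
Proof.
move=> mE; apply: le_caratheodory_measurable => A.
have [->|Aoo] := eqVneq (mu A) +oo; first by rewrite leey.
pose M := \bigcup_(t in pi @` A) (E `&` [set x | pi x = t]).
have mM : mu.-cara.-measurable M.
  apply: countable_bigcup_measurable => //.
  by apply: picount; rewrite ltey.
have AE x : A x -> E x <-> M x.
  by move=> Ax; split => [Ex|[t _ []]//]; exists (pi x) => //; exists x.
rewrite [leRHS](mM A); apply: leeD; apply: le_outer_measure => x [Ax Ex].
  by split => //; exact/(AE _ Ax).
by split => // Mx; apply: Ex; exact/(AE _ Ax).
Qed.

Lemma fiberwise_measure (f : I -> nat) (E : set T) :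
    mu.-cara.-measurable E -> {in pi @` E &, injective f} ->
  mu E = \sum_(k <oo) mu (E `&` [set x | f (pi x) = k]).
Proof.
move=> mE finj.
have mk k : mu.-cara.-measurable (E `&` [set x | f (pi x) = k]).
  have [[x [Ex fx]]|none] := pselect (exists x, E x /\ f (pi x) = k).
    rewrite (_ : _ `&` _ = E `&` [set y | pi y = pi x]).
      exact: measurableI.
    apply/seteqP; split => y [Ey /= yx]; split => //=; last by rewrite yx.
    by apply: finj; rewrite ?inE ?yx//=; [exists y|exists x].
  rewrite (_ : _ `&` _ = set0)//.
  by apply/seteqP; split => // x [Ex fx]; apply: none; exists x.
pose A k := E `&` [set x | f (pi x) = k].
have AE k : E `&` A k = A k by rewrite setIA setIid.
have tA : trivIset setT A.
  apply/trivIsetP => j k _ _ jk; apply/seteqP; split => // x [[_ /= xj] [_ /= xk]].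
  by move: jk; rewrite -xj -xk eqxx.
apply/le_anti/andP; split.
  apply: le_trans (outer_measure_sigma_subadditive mu A).
  by apply: le_outer_measure => x Ex; exists (f (pi x)).
have := caratheodory_lime_le mk tA E.
by under eq_eseriesr do rewrite -/(A _) AE; apply: le_trans; rewrite leeDl// outer_measure_ge0.
Qed.

End fiber_gluing.

Section glued_isomorphism.
Context {R : realType} {T T' : pointedType} {I : Type}.
Context (mu : {outer_measure set T -> \bar R}) (pi : T -> I).
Context (mu' : {outer_measure set T' -> \bar R}) (pi' : T' -> I).
Local Open Scope ereal_scope.
Hypothesis mpi : forall t, mu.-cara.-measurable [set x | pi x = t].
Hypothesis picount : forall A, mu A < +oo -> countable (pi @` A).
Hypothesis mpi' : forall t, mu'.-cara.-measurable [set x | pi' x = t].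
Hypothesis picount' : forall A, mu' A < +oo -> countable (pi' @` A).
Context (F : I -> T -> T').
Hypothesis F_bij : forall t, set_bij [set x | pi x = t] [set y | pi' y = t] (F t).
Hypothesis F_image : forall t E, mu.-cara.-measurable E ->
  E `<=` [set x | pi x = t] ->
  mu'.-cara.-measurable (F t @` E) /\ mu' (F t @` E) = mu E.
Hypothesis F_preimage : forall t E, mu'.-cara.-measurable E ->
  E `<=` [set y | pi' y = t] ->
  mu.-cara.-measurable ([set x | pi x = t] `&` F t @^-1` E).

Definition glued (x : T) : T' := F (pi x) x.

Let pi_glued x : pi' (glued x) = pi x.
Proof. by have [fun_ _ _] := F_bij (pi x); exact: (fun_ x). Qed.

Lemma glued_bij : bijective glued.
Proof.
have ginj x y : glued x = glued y -> x = y.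
  move=> gxy; have pxy : pi x = pi y by rewrite -!pi_glued gxy.
  have [_ inj_ _] := F_bij (pi x).
  by apply: inj_; rewrite ?inE//=; move: gxy; rewrite /glued -pxy.
have /choice[h hK] : forall y, exists x, glued x = y.
  move=> y; have [_ _ surj_] := F_bij (pi' y).
  by have [x /= px Fx] := surj_ y erefl; exists x; rewrite /glued px.
by exists h => // x; apply: ginj; rewrite hK.
Qed.

Lemma glued_fiber E t :
  glued @` E `&` [set y | pi' y = t] = F t @` (E `&` [set x | pi x = t]).
Proof.
apply/seteqP; split => [_ [[x Ex <-] /= px]|_ [x [Ex /= px] <-]].
  by rewrite pi_glued in px; exists x; rewrite /glued ?px.
split; first by exists x => //; rewrite /glued px.
by have [fun_ _ _] := F_bij t; exact: (fun_ x px).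
Qed.

(** If [E] meets only countably many fibers, its measure is the sum over the
    fibers; otherwise both [E] and its image have infinite measure. *)
Lemma glued_image E : mu.-cara.-measurable E ->
  mu'.-cara.-measurable (glued @` E) /\ mu' (glued @` E) = mu E.
Proof.
move=> mE; have mfib t : mu.-cara.-measurable (E `&` [set x | pi x = t]).
  exact: measurableI.
have mgE : mu'.-cara.-measurable (glued @` E).
  apply: (fiberwise_measurable picount') => t.
  by rewrite glued_fiber; apply: (F_image _ _).1 => // x [].
split => //.
have piE : pi' @` (glued @` E) = pi @` E.
  apply/seteqP; split => [_ [_ [x Ex <-] <-]|_ [x Ex <-]].
    by exists x; rewrite ?pi_glued.
  by exists (glued x); [exists x|rewrite pi_glued].
have [/countable_injP[f finj]|Eunc] := pselect (countable (pi @` E)); last first.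
  have [Eoo|] := eqVneq (mu E) +oo; last first.
    by rewrite -ltey => /picount.
  rewrite Eoo; apply/eqP; rewrite -leye_eq leNgt; apply/negP => /picount'.
  by rewrite piE.
rewrite (fiberwise_measure mpi mE finj).
have finj' : {in pi' @` (glued @` E) &, injective f} by rewrite piE.
rewrite (fiberwise_measure mpi' mgE finj').
apply: eq_eseriesr => k _.
(* For each [k] at most one fiber contributes to the sums. *)
have [[x [Ex fx]]|none] := pselect (exists x, E x /\ f (pi x) = k).
  have kE : E `&` [set y | f (pi y) = k] = E `&` [set y | pi y = pi x].
    apply/seteqP; split => y [Ey /= yx]; split => //=; last by rewrite yx.
    by apply: finj; rewrite ?inE ?yx//=; [exists y|exists x].
  have [_ FE] := F_image (mfib (pi x)) (@subIsetr _ E [set y | pi y = pi x]).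
  rewrite kE -FE -glued_fiber; congr (mu' _).
  apply/seteqP; split => y [gy /= yx]; split => //=; last by rewrite yx.
  have Ey : (pi @` E) (pi' y) by rewrite -piE; exists y.
  by apply: finj; rewrite ?inE ?yx//=; exists x.
rewrite (_ : E `&` _ = set0); last first.
  by apply/seteqP; split => // x [Ex fx]; apply: none; exists x.
rewrite (_ : _ `&` _ = set0) ?outer_measure0//.
apply/seteqP; split => // _ [[x Ex <-] /=]; rewrite pi_glued => fx.
by apply: none; exists x.
Qed.

Lemma glued_preimage E : mu'.-cara.-measurable E ->
  mu.-cara.-measurable (glued @^-1` E) /\ mu (glued @^-1` E) = mu' E.
Proof.
move=> mE; have mgE : mu.-cara.-measurable (glued @^-1` E).
  apply: (fiberwise_measurable picount) => t.
  rewrite (_ : _ `&` _ =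
      [set x | pi x = t] `&` F t @^-1` (E `&` [set y | pi' y = t])).
    by apply: F_preimage => [|y []//]; exact: measurableI.
  apply/seteqP; split => x.
    by move=> [Ex /= px]; move: Ex; rewrite /= /glued px => Ex; split => //; split => //;
      have [fun_ _ _] := F_bij t; exact: (fun_ x px).
  by move=> [/= px [Ex _]]; split => //=; rewrite /glued px.
split => //; rewrite -(glued_image mgE).2; congr (mu' _).
apply/seteqP; split => [_ [x Ex <-]//|y Ey].
have [h hK hK'] := glued_bij.
by exists (h y); rewrite /= ?hK'.
Qed.

End glued_isomorphism.

Theorem theorem0p3 (R : realType) (n : nat) (d1 d2 : R)
    (CH : continuum_hypothesis R) (n_gt0 : (0 < n)%N)
    (d1_gt0 : 0 < d1) (d1_le_d2 : d1 <= d2) (d2_lt_n : d2 < n%:R) :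
  measure_spaces_isomorphic (hausdorff_measure n d1) (hausdorff_measure n d2).
Proof.
have d2_gt0 := lt_le_trans d1_gt0 d1_le_d2.
have d1_lt_n := le_lt_trans d1_le_d2 d2_lt_n.
have [pi [mpi picount block]] := hausdorff_blocks CH n_gt0 d1_gt0 d1_lt_n.
have [pi' [mpi' picount' block']] := hausdorff_blocks CH n_gt0 d2_gt0 d2_lt_n.
have /choice[F HF] : forall t, exists f : 'rV[R]_n -> 'rV[R]_n, [/\
    set_bij [set x | pi x = t] [set y | pi' y = t] f,
    forall E, (hausdorff d1).-cara.-measurable E -> E `<=` [set x | pi x = t] ->
      (hausdorff d2).-cara.-measurable (f @` E) /\
      hausdorff d2 (f @` E) = hausdorff d1 E &
    forall E, (hausdorff d2).-cara.-measurable E -> E `<=` [set y | pi' y = t] ->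
      (hausdorff d1).-cara.-measurable ([set x | pi x = t] `&` f @^-1` E) /\
      hausdorff d1 ([set x | pi x = t] `&` f @^-1` E) = hausdorff d2 E].
  move=> t; have [D1 [g [Z [crd ZD Z0 Zunc]]]] := block t.
  have [D1' [g' [Z' [crd' ZD' Z0' Zunc']]]] := block' t.
  by apply: (block_isomorphism CH crd crd' (@separating_inj R n)
    (@separating_inj R n) ZD Z0 Zunc ZD' Z0' Zunc').
have F_bij t := let: And3 h _ _ := HF t in h.
have F_image t E mE ED := let: And3 _ h _ := HF t in h E mE ED.
have F_preimage t E mE ED := let: And3 _ _ h := HF t in (h E mE ED).1.
exists (glued pi F); split.
- exact: glued_bij F_bij.
- exact: (glued_image mpi picount mpi' picount' F_bij F_image).
- exact: (glued_preimage mpi picount mpi' picount' F_bij F_image F_preimage).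
Qed.
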